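(* For any $T\in\mathbf{T}_n^2$ the ideal of definition $I(\mathcal{U}_T)$ is the radical of $\mathcal{I}_{\mathcal{B}_T}$, that is, $$I(\mathcal{U}_T)=\sqrt{\mathcal{I}_{\mathcal{B}_T}}.$$
   Context: Let $\mathfrak{n}$ be the space of strictly upper-triangular complex $n\times n$ matrices. The bar denotes (Zariski) closure in $\mathfrak{n}$. For an upper-triangular matrix $u$ and $i\le j$ let $\pi_{i,j}(u)$ be the submatrix of $u$ with rows and columns $i,\dots,j$. Shapes and orbital varieties. For a nilpotent matrix $u$ let $\mathrm{sh}(u)=\lambda=(\lambda_1,\lambda_2,\dots)$ be the conjugate (dual) of the partition formed by the sizes of the Jordan blocks of $u$, i.e. $\lambda_i$ is the number of Jordan blocks of size at least $i$; let $\mathcal{O}_\lambda$ be the set (conjugacy class) of nilpotent $n\times n$ matrices $u$ with $\mathrm{sh}(u)=\lambda$. A Young diagram of shape $\lambda$ has $i$-th column of length $\lambda_i$; a standard Young tableau is a filling with $1,\dots,n$ increasing along rows (left to right) and down columns. For a standard Young tableau $T$ of shape $\lambda$ let $\nu_T$ be the set of $u\in\mathfrak{n}$ such that for every $1\le i\le n$, $\mathrm{sh}(\pi_{1,i}(u))$ equals the shape of the subtableau of $T$ consisting of the entries $1,\dots,i$. The orbital variety attached to $T$ is $\mathcal{U}_T=\overline{\nu_T}\cap\mathcal{O}_\lambda$. $\mathbf{T}_n^2$ is the set of standard Young tableaux with $n$ boxes and (at most) two columns; write $T=(T_1,T_2)$ with first column $T_1$ with entries $t_{1,1}<\dots<t_{l,1}$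 and second column $T_2$ with entries $t_{1,2}<\dots<t_{k,2}$. For $1\le i<j\le n$ let $x_{j,i}$ be the coordinate function $u\mapsto u_{i,j}$ on $\mathfrak{n}$, so the ring of polynomial functions on $\mathfrak{n}$ is $\mathbb{C}[x_{j,i}:i<j]$ (identified with $S(\mathfrak{n}^-)$). $I(\mathcal{U}_T)$ is the ideal of definition of $\overline{\mathcal{U}}_T$: the radical ideal in this ring whose zero variety is $\overline{\mathcal{U}}_T$. The ideal $\mathcal{I}_{\mathcal{B}_T}$. Define the involution $\sigma_T=(i_1,j_1)\cdots(i_k,j_k)$ by $j_s=t_{s,2}$, $i_1=t_{1,2}-1$, and $i_s=\max\{d\in T_1\setminus\{i_1,\dots,i_{s-1}\} : d<j_s\}$ for $s>1$. Let $N_{\sigma_T}$ be the matrix with entries $1$ at positions $(i_s,j_s)$, $1\le s\le k$, and $0$ elsewhere; $\mathcal{B}_T$ denotes the orbit of $N_{\sigma_T}$ under conjugation by invertible upper-triangular matrices. For $i<j$ let $(R_{\sigma_T})_{i,j}=\mathrm{rank}\,\pi_{i,j}(N_{\sigma_T})$. Let $N$ be the generic strictly upper-triangular matrix with $(i,j)$ entry $x_{j,i}$ for $i<j$. Then $\mathcal{I}_{\mathcal{B}_T}=\mathcal{I}_{\sigma_T}$ is the ideal generated by the entries of $N^2$ (i.e. $\sum_{k=j+1}^{i-1}x_{i,k}x_{k,j}$, $1\le j<i\le n$) together with all minors of size $(R_{\sigma_T})_{i,j}+1$ of $\pi_{i,j}(N)$, for all $1\le i<j\le n$. *)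

(* Defs.v *)
From mathcomp Require Import all_boot all_order all_algebra.
From mathcomp Require Import reals complex mpoly.

Set Implicit Arguments.
Unset Strict Implicit.
Unset Printing Implicit Defensive.

Import GRing.Theory.
Local Open Scope ring_scope.

(* The complex field is R[i] for R : realType.  Matrices are indexed by 'I_n
   (from 0); tableau entries are natural numbers 1, ..., n, so that the entry
   m corresponds to the row and column of index m - 1. *)

(** ** Submatrices and minors *)

Lemma rng_subproof n (i j : 'I_n) (a : 'I_(j.+1 - i)) : (i + a < n)%N.
Proof.
have := ltn_ord a; rewrite ltn_subRL => /leq_trans; apply; exact: ltn_ord.
Qed.

Definition rng n (i j : 'I_n) (a : 'I_(j.+1 - i)) : 'I_n :=
  Ordinal (rng_subproof a).

Definition pi_sub (K : Type) n (i j : 'I_n) (u : 'M[K]_n) :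
  'M[K]_(j.+1 - i) := mxsub (@rng n i j) (@rng n i j) u.

Definition ord_first n (i : 'I_n) : 'I_n :=
  Ordinal (leq_ltn_trans (leq0n i) (ltn_ord i)).

Definition is_minor (A : comNzRingType) m p (r : nat) (M : 'M[A]_(m, p))
    (d : A) : Prop :=
  exists (f : 'I_r -> 'I_m) (g : 'I_r -> 'I_p),
    [/\ forall a b : 'I_r, (a < b)%N -> (f a < f b)%N,
        forall a b : 'I_r, (a < b)%N -> (g a < g b)%N
      & d = \det (mxsub f g M)].

(** ** Nilpotent Jordan forms and shapes *)

Definition nilp_jordan_block (K : fieldType) (m : nat) : 'M[K]_m :=
  \matrix_(a < m, b < m) (a.+1 == b :> nat)%:R.

Definition nilp_jordan_mx (K : fieldType) k (p : 'I_k -> nat) :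
  'M[K]_(\sum_i p i) := \mxdiag_(i < k) nilp_jordan_block K (p i).

(* u is nilpotent and its Jordan blocks have sizes p 0, ..., p (k - 1).  The
   change of basis P has two-sided inverse Q; the two dimensions are only
   propositionally equal, hence the rectangular matrices. *)
Definition has_jordan_sizes (K : fieldType) m (u : 'M[K]_m) k
    (p : 'I_k -> nat) : Prop :=
  (forall i, 0 < p i)%N /\
  exists (P : 'M[K]_(\sum_i p i, m)) (Q : 'M[K]_(m, \sum_i p i)),
    [/\ P *m Q = 1%:M, Q *m P = 1%:M & u = Q *m nilp_jordan_mx K p *m P].

(* u is nilpotent and sh(u) = lam, up to trailing zeros: the (c+1)-st part of
   lam is the number of Jordan blocks of size at least c+1. *)
Definition has_shape (K : fieldType) m (u : 'M[K]_m) (lam : seq nat) : Prop :=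
  exists k (p : 'I_k -> nat), has_jordan_sizes u p /\
    forall c : nat, nth 0%N lam c = #|[set i | (c < p i)%N]|.

(** ** Standard Young tableaux with at most two columns *)

Record tableau2 (n : nat) := Tableau2 {
  col1 : seq nat;
  col2 : seq nat;
  tab_entries : perm_eq (col1 ++ col2) (iota 1 n);
  col1_sorted : sorted ltn col1;
  col2_sorted : sorted ltn col2;
  col_sizes : (size col2 <= size col1)%N;
  rows_increasing : forall s : nat, (s < size col2)%N ->
    (nth 0 col1 s < nth 0 col2 s)%N
}.

(* Column lengths of the subtableau with entries 1, ..., m. *)
Definition subshape n (T : tableau2 n) (m : nat) : seq nat :=
  [:: count (fun t => t <= m)%N (col1 T); count (fun t => t <= m)%N (col2 T)].

Definition shape2 n (T : tableau2 n) : seq nat :=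
  [:: size (col1 T); size (col2 T)].

(* The 2-cycles (i_s, j_s) of the involution sigma_T, in the order s = 1..k;
   [used] holds i_1, ..., i_{s-1}. *)
Fixpoint match_cols (c1 used c2 : seq nat) : seq (nat * nat) :=
  if c2 is j :: c2' then
    let i := (\max_(d <- c1 | (d \notin used) && (d < j)) d)%N in
    (i, j) :: match_cols c1 (i :: used) c2'
  else [::].

Definition sigma_cycles n (T : tableau2 n) : seq (nat * nat) :=
  if col2 T is j1 :: c2' then
    (j1.-1, j1) :: match_cols (col1 T) [:: j1.-1] c2'
  else [::].

(** ** The ring of polynomial functions on strictly upper-triangular matrices *)

Definition pos (n : nat) : finType := {p : 'I_n * 'I_n | (p.1 < p.2)%N}.

Notation polyfun R n := {mpoly (complex R)[#|{: pos n}|]}.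

Definition polyset (R : realType) (n : nat) := polyfun R n -> Prop.
Definition mxset (R : realType) (n : nat) := 'M[complex R]_n -> Prop.

(* The (i, j) entry is the coordinate function u |-> u i j for i < j. *)
Definition generic_mx (R : realType) (n : nat) : 'M[polyfun R n]_n :=
  \matrix_(i, j) if insub (i, j) is Some p then 'X_(enum_rank (p : pos n))
                 else 0.

Definition mxeval (R : realType) n (f : polyfun R n) (u : 'M[complex R]_n) :
  complex R :=
  f.@[fun v => let q := val (enum_val v : pos n) in u q.1 q.2].

Definition strict_upper (R : realType) n : mxset R n :=
  fun u => forall i j : 'I_n, (j <= i)%N -> u i j = 0.

Definition zeros (R : realType) n (E : polyset R n) : mxset R n :=
  fun u => strict_upper u /\ forall f, E f -> mxeval f u = 0.

(* The intersection of all Zariski closed subsets containing Z, for a set Z of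
   strictly upper-triangular matrices. *)
Definition zariski_closure (R : realType) n (Z : mxset R n) : mxset R n :=
  fun u => forall E : polyset R n,
    (forall v, Z v -> zeros E v) -> zeros E u.

Definition is_ideal (R : realType) n (J : polyset R n) : Prop :=
  [/\ J 0, forall f g, J f -> J g -> J (f + g)
    & forall h f, J f -> J (h * f)].

Definition radical (R : realType) n (J : polyset R n) : polyset R n :=
  fun f => exists k : nat, (0 < k)%N /\ J (f ^+ k).

Definition ideal_gen (R : realType) n (G : polyset R n) : polyset R n :=
  fun f => exists m (c g : 'I_m -> polyfun R n),
    (forall k, G (g k)) /\ f = \sum_k c k * g k.

Definition is_ideal_of_definition (R : realType) n (Z : mxset R n)
    (J : polyset R n) : Prop :=
  [/\ is_ideal J, forall f, radical J f -> J f
    & forall u, zeros J u <-> zariski_closure Z u].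

(** ** Orbital varieties and the ideal attached to sigma_T *)

Definition nu (R : realType) n (T : tableau2 n) : mxset R n :=
  fun u => strict_upper u /\
    forall i : 'I_n, has_shape (pi_sub (ord_first i) i u) (subshape T i.+1).

Definition orbital_variety (R : realType) n (T : tableau2 n) : mxset R n :=
  fun u => zariski_closure (nu T) u /\ has_shape u (shape2 T).

Definition N_sigma (R : realType) n (T : tableau2 n) : 'M[complex R]_n :=
  \matrix_(i, j) ((i.+1, j.+1) \in sigma_cycles T)%:R.

Definition R_sigma (R : realType) n (T : tableau2 n) (i j : 'I_n) : nat :=
  \rank (pi_sub i j (N_sigma R T)).

Definition B_generator (R : realType) n (T : tableau2 n) : polyset R n :=
  fun f =>
    (exists i j : 'I_n,
       (i < j)%N /\ f = (generic_mx R n *m generic_mx R n) i j) \/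
    (exists i j : 'I_n,
       (i < j)%N /\
       is_minor (R_sigma R T i j).+1 (pi_sub i j (generic_mx R n)) f).

Definition ideal_B (R : realType) n (T : tableau2 n) : polyset R n :=
  ideal_gen (B_generator T).
Arguments orbital_variety R [n] T.
Arguments ideal_B R [n] T.

(* Main.v *)
(* Number the points from 0, and let o[x, k) and c[k, y) count the entries of the
   first and of the second column of T in the windows [x, k) and [k, y).  Since
   sigma_T matches last-in-first-out, the rank of N_{sigma_T} in the window [x, y)
   is the minimum over k of o[x, k) + c[k, y).  For u in nu_T the same bounds hold
   on the ranks of the windows of u: this is a dimension count in the kernel and
   the image of u on the standard flag.  So nu_T lies in the zero set X of
   I_{B_T}, and nu_T consists of the points of X whose windows [0, m) have the
   largest possible rank c[0, m).

   Conversely, u in X is conjugate, under the upper triangular group, to the matrix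
   of an arc diagram.  If u is not in nu_T, the first point which should close an
   arc and does not yields a modification of the diagram (adding, shortening or
   uncrossing arcs) that respects the bounds and enlarges some rank; the
   modification is realized by a line through u whose other points belong to X.
   By induction on the ranks those points lie in the closure of nu_T, and so does u.
   Hence X is the closure of U_T and the theorem follows from the Nullstellensatz. *)
Require Import Defs.
From mathcomp Require Import all_boot all_order all_algebra.
From mathcomp Require Import reals complex mpoly.
From mathcomp Require Import boolp zify ring.
From mathcomp Require classical_sets.
Import Defs.

Set Implicit Arguments.
Unset Strict Implicit.
Unset Printing Implicit Defensive.
Import GRing.Theory.

(** * Arc diagrams *)

(** The ranks of windows are unchanged when a matrix is multiplied on its two sides by unrelated
    upper triangular units. A point of a line through [u] may therefore be compared with the matrix
    of the new diagram by two-sided equivalence, through explicit elementary matrices; that its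
    square is zero is checked directly. The obstacle is combinatorial: a modification that enlarges
    one window must respect the bounds on all windows, for every cut [k]. Hence every choice is
    extremal: the first defective point, the arc over it that ends first, the first start of a
    window whose bound is attained. A line reaches the closure because a polynomial in [t] that
    vanishes for [t != 0] vanishes at 0. The Nullstellensatz is obtained one variable at a time, in
    the form: a prime ideal avoiding [c] has a point at which [c] does not vanish. This form, with
    [c] arbitrary, is what survives the passage from [A] to [{poly A}]. *)

Lemma uniq_map_inj (T U : eqType) (f : T -> U) (s : seq T) :
  uniq (map f s) -> {in s &, injective f}.
Proof.
elim: s => [//|p s IH] /= /andP[ps us] a b; rewrite !inE.
case/orP=> [/eqP->|abs] /orP[/eqP->|acs] // e; last exact: IH.
- by case/negP: ps; apply/mapP; exists b.
- by case/negP: ps; apply/mapP; exists a.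
Qed.

Section ArcDiagrams.
Implicit Types (l : seq (nat * nat)) (closing : pred nat) (n m x y k : nat).

Definition closers closing x y := \sum_(x <= p < y) closing p.
Definition openers closing x y := \sum_(x <= p < y) ~~ closing p.

Definition arc_count l x y := count (fun a => (x <= a.1) && (a.2 < y)) l.

Definition arc_diagram n l :=
  all (fun a => a.1 < a.2 < n) l && uniq (map fst l ++ map snd l).

(* For the points closing in a tableau, the minimum over [k] of the right-hand
   side is the number of arcs of sigma_T in the window [x, y). *)
Definition bounded_by closing n l := forall x k y, x <= k -> k <= y -> y <= n ->
  arc_count l x y <= openers closing x k + closers closing k y.

(* The minimal degenerations of orbits of square-zero matrices, read upwards:
   the matrix of [l] is a limit of conjugates of the matrix of the new diagram. *)
Inductive arc_move l : seq (nat * nat) -> Prop :=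
| Move_add a b : a < b -> a \notin map fst l ++ map snd l ->
    b \notin map fst l ++ map snd l -> arc_move l ((a, b) :: l)
| Move_close a m b l0 : perm_eq l ((a, b) :: l0) -> a < m < b ->
    m \notin map fst l ++ map snd l -> arc_move l ((a, m) :: l0)
| Move_open m f b l0 : perm_eq l ((m, b) :: l0) -> m < f < b ->
    f \notin map fst l ++ map snd l -> arc_move l ((f, b) :: l0)
| Move_nest a b c d l0 : perm_eq l [:: (a, c), (b, d) & l0] ->
    a < b < c -> c < d -> arc_move l [:: (a, d), (b, c) & l0]
| Move_uncross a b c d l0 : perm_eq l [:: (a, c), (b, d) & l0] ->
    a < b < c -> c < d -> arc_move l [:: (a, b), (c, d) & l0].

Lemma closersD closing x k y : x <= k -> k <= y ->
  closers closing x y = closers closing x k + closers closing k y.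
Proof. by move=> xk ky; rewrite /closers (big_cat_nat xk ky). Qed.

Lemma openersD closing x k y : x <= k -> k <= y ->
  openers closing x y = openers closing x k + openers closing k y.
Proof. by move=> xk ky; rewrite /openers (big_cat_nat xk ky). Qed.

Lemma closersS closing x y : x <= y ->
  closers closing x y.+1 = closers closing x y + closing y.
Proof. by move=> xy; rewrite /closers big_nat_recr. Qed.

Lemma openersS closing x y : x <= y ->
  openers closing x y.+1 = openers closing x y + ~~ closing y.
Proof. by move=> xy; rewrite /openers big_nat_recr. Qed.

Lemma closers_geq closing x y : y <= x -> closers closing x y = 0.
Proof. by move=> yx; rewrite /closers big_geq. Qed.

Lemma openers_geq closing x y : y <= x -> openers closing x y = 0.
Proof. by move=> yx; rewrite /openers big_geq. Qed.

Lemma openers_closers closing x y :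
  openers closing x y + closers closing x y = y - x.
Proof.
rewrite /openers /closers -big_split /= -[RHS]muln1 -sum_nat_const_nat.
by apply: eq_bigr => i _; case: (closing i).
Qed.

Lemma count_sum_eq (s : seq (nat * nat)) (f : nat * nat -> nat) (P : pred (nat * nat))
    x y : (forall a, a \in s -> P a -> x <= f a < y) ->
  \sum_(x <= p < y) count (fun a => (f a == p) && P a) s = count P s.
Proof.
elim: s => [|a s IH] H; first by rewrite big1.
rewrite /= big_split /= IH; last by move=> b bs; apply: H; rewrite inE bs orbT.
congr (_ + _); case Pa: (P a); last by rewrite big1 // => i _; rewrite andbF.
have /H := mem_head a s; rewrite Pa => /(_ isT) /andP[xa ay].
rewrite (bigD1_seq (f a)) ?mem_index_iota ?xa ?iota_uniq //= eqxx big1 //.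
by move=> i /negPf; rewrite eq_sym => ->.
Qed.

Lemma arc_count_perm l l' x y : perm_eq l l' -> arc_count l x y = arc_count l' x y.
Proof. by move/seq.permP; apply. Qed.

Section Diagram.
Variables (n : nat) (l : seq (nat * nat)).
Hypothesis ld : arc_diagram n l.

Lemma arc_lt a b : (a, b) \in l -> a < b < n.
Proof. by case/andP: ld => /allP H _ /H. Qed.

Lemma arc_disjoint a b c : (a, b) \in l -> (c, a) \in l -> False.
Proof.
case/andP: ld => _; rewrite cat_uniq => /and3P[_ /hasPn H _] ab ca.
have /H : a \in map snd l by apply/mapP; exists (c, a).
by apply/negP; rewrite negbK; apply/mapP; exists (a, b).
Qed.

Lemma arc_fst_inj a b c : (a, b) \in l -> (a, c) \in l -> b = c.
Proof.
case/andP: ld => _; rewrite cat_uniq => /and3P[u _ _] ab ac.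
by have [] := uniq_map_inj u ab ac erefl.
Qed.

Lemma arc_count_fst x y :
  arc_count l x y =
  \sum_(x <= p < y) count (fun a => (a.1 == p) && (a.2 < y)) l.
Proof.
rewrite /arc_count -(@count_sum_eq l fst (fun a => (x <= a.1) && (a.2 < y)) x y).
  apply: eq_big_nat => i /andP[xi _]; apply: eq_count => a /=.
  by case: eqP => // ->; rewrite xi.
by case=> a b /arc_lt /= ab /andP[xa lb]; lia.
Qed.

Lemma arc_count_snd x y :
  arc_count l x y =
  \sum_(x <= p < y) count (fun a => (a.2 == p) && (x <= a.1)) l.
Proof.
rewrite /arc_count -(@count_sum_eq l snd (fun a => (x <= a.1) && (a.2 < y)) x y).
  apply: eq_big_nat => i /andP[_ iy]; apply: eq_count => a /=.
  by case: eqP => // ->; rewrite iy andbT.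
by case=> a b /arc_lt /= ab /andP[xa lb]; lia.
Qed.

Lemma count_fst_le1 (P : pred (nat * nat)) p :
  count (fun a => (a.1 == p) && P a) l <= (p \in map fst l).
Proof.
case/andP: ld => _; rewrite cat_uniq => /and3P[u _ _].
rewrite -(count_uniq_mem p u) count_map; apply: sub_count => a /=.
by case/andP.
Qed.

Lemma count_snd_le1 (P : pred (nat * nat)) p :
  count (fun a => (a.2 == p) && P a) l <= (p \in map snd l).
Proof.
case/andP: ld => _; rewrite cat_uniq => /and3P[_ _ u].
rewrite -(count_uniq_mem p u) count_map; apply: sub_count => a /=.
by case/andP.
Qed.

Lemma arc_rem a b : (a, b) \in l -> perm_eq l ((a, b) :: rem (a, b) l).
Proof. exact: perm_to_rem. Qed.

End Diagram.

Lemma arc_diagram_perm n l l' : perm_eq l l' -> arc_diagram n l -> arc_diagram n l'.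
Proof.
move=> p /andP[a u]; rewrite /arc_diagram -(perm_all _ p) a /=.
by rewrite -(perm_uniq (perm_cat (perm_map fst p) (perm_map snd p))).
Qed.

Lemma perm_two_rem (l : seq (nat * nat)) a b : a != b -> a \in l -> b \in l ->
  perm_eq l [:: a, b & rem b (rem a l)].
Proof.
move=> ab al bl; apply: (perm_trans (perm_to_rem al)); rewrite perm_cons.
apply: perm_to_rem; move: bl; rewrite (perm_mem (perm_to_rem al)) inE.
by rewrite eq_sym (negPf ab).
Qed.

Lemma arc_pts_perm l l' : perm_eq l l' ->
  map fst l ++ map snd l =i map fst l' ++ map snd l'.
Proof.
by move=> p; apply: perm_mem; apply: perm_cat; apply: perm_map.
Qed.

Lemma uniq_count_le1 (T : eqType) (s : seq T) :
  reflect (forall z, count_mem z s <= 1) (uniq s).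
Proof.
apply: (iffP idP) => [u z|]; first by rewrite count_uniq_mem // leq_b1.
elim: s => [//|a s IH] /= H; rewrite IH => [|z]; last first.
  by apply: leq_trans (H z); rewrite leq_addl.
by rewrite andbT; apply/count_memPn; have := H a; rewrite eqxx; case: (count _ _).
Qed.

Lemma arc_diagram_uniq n l : arc_diagram n l -> uniq (map fst l ++ map snd l).
Proof. by case/andP. Qed.

Lemma arc_diagramI n l : all (fun a => a.1 < a.2 < n) l ->
  uniq (map fst l ++ map snd l) -> arc_diagram n l.
Proof. by rewrite /arc_diagram => -> ->. Qed.

Lemma arc_move_diagram n l l' : arc_diagram n l -> all (fun a => a.2 < n) l' ->
  arc_move l l' -> arc_diagram n l'.
Proof.
(* Each move is checked on the multiplicities of end points: one free point at a time enters the
   list. *)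
have U (s s' : seq nat) a : uniq s -> a \notin s -> (forall z, count_mem z s' <= count_mem z s + (a == z)) -> uniq s'.
  move=> /uniq_count_le1 u /count_memPn as0 H; apply/uniq_count_le1 => z.
  by have := H z; have := u z; case: eqP => [<-|_]; lia.
move=> ld h mv; case: mv h => [a b ab na nb|a m b l0 p amb nm|m f b l0 p amb nm
  |a b c d l0 p abc cd|a b c d l0 p abc cd] /= /andP[hb h].
- case/andP: ld => A /= u; rewrite /arc_diagram [all _ _]/= ab hb A !andTb.
  have u' : uniq (a :: (map fst l ++ map snd l)) by rewrite /= na.
  apply: (U _ _ b u') => [|z]; first by rewrite inE negb_or nb andbT gtn_eqF.
  by rewrite /= !count_cat /=; lia.
all: move: (arc_diagram_perm p ld); rewrite {1}/arc_diagram => /andP[/= A u]; apply: arc_diagramI; rewrite ?[all _ _]/=.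
- by case/andP: A => _ ->; rewrite andbT /=; lia.
- rewrite (arc_pts_perm p) in nm; apply: (U (map fst ((a, b) :: l0) ++ map snd ((a, b) :: l0)) _ m u nm) => z.
  by rewrite /= !count_cat /=; lia.
- by case/andP: A => _ ->; rewrite andbT /=; lia.
- rewrite (arc_pts_perm p) in nm; apply: (U (map fst ((m, b) :: l0) ++ map snd ((m, b) :: l0)) _ f u nm) => z.
  by rewrite /= !count_cat /=; lia.
- by case/and3P: A => ? ? ->; rewrite andbT /=; lia.
- apply/uniq_count_le1 => z; have := elimT (uniq_count_le1 (map fst [:: (a, c), (b, d) & l0] ++ map snd [:: (a, c), (b, d) & l0])) u z.
  by rewrite /= !count_cat /=; lia.
- by case/and3P: A => ? ? ->; rewrite andbT /=; lia.
- apply/uniq_count_le1 => z; have := elimT (uniq_count_le1 (map fst [:: (a, c), (b, d) & l0] ++ map snd [:: (a, c), (b, d) & l0])) u z.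
  by rewrite /= !count_cat /=; lia.
Qed.
End ArcDiagrams.

(** * Raising a diagram at its first defective point *)

Section Raise.
Variables (closing : pred nat) (n : nat) (l : seq (nat * nat)).
Hypothesis ballot : forall m, m <= n -> closers closing 0 m <= openers closing 0 m.
Hypothesis ld : arc_diagram n l.
Hypothesis lb : bounded_by closing n l.
Let C := map snd l.
Let O := map fst l.

(** The strict gain is asked of a window with ends at most [n], so that it shows up in the finite
    sum [total_rank] that drives the final induction. *)
Definition raises l' := [/\ arc_move l l', arc_diagram n l', bounded_by closing n l',
  forall x y, arc_count l x y <= arc_count l' x y &
  exists x y, [/\ x <= n, y <= n & arc_count l x y < arc_count l' x y]].

Lemma arc_count_prefix m : arc_count l 0 m = \sum_(0 <= p < m) (p \in C).
Proof.
rewrite (arc_count_snd ld); apply: eq_bigr => p _.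
have u : uniq C by move: (arc_diagram_uniq ld); rewrite cat_uniq => /and3P[].
by rewrite -(count_uniq_mem p u) count_map; apply: eq_count => a /=; rewrite andbT.
Qed.

Variable m : nat.
Hypotheses (mn : m < n) (closing_m : closing m) (mC : m \notin C).
Hypothesis agree : forall p, p < m -> closing p = (p \in C).

Lemma closers_prefix : closers closing 0 m = arc_count l 0 m.
Proof.
by rewrite arc_count_prefix; apply: eq_big_nat => p /andP[_ /agree ->].
Qed.

Lemma fst_not_closing a b : (a, b) \in l -> a < m -> ~~ closing a.
Proof.
move=> ab am; rewrite agree //; apply/negP => /mapP[[p q] pq /= ?]; subst.
exact: (arc_disjoint ld ab pq).
Qed.

(* The point [m] must become a closer; [a] can be its opener provided that
   no arc of the window passes over [m]. *)
Lemma raise_window a x k y :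
  a < m -> ~~ closing a -> (forall b, (a, b) \in l -> y <= b) ->
  (forall e f, (e, f) \in l -> e <= m -> m < f -> y <= f) ->
  x <= a -> m < y -> y <= n -> x <= k -> k <= y ->
  (arc_count l x y).+1 <= openers closing x k + closers closing k y.
Proof.
move=> am ca ay over xa my yn xk ky.
have mS : closers closing m m.+1 = 1 by rewrite closersS // closers_geq // closing_m.
(* No arc of the window straddles [m]: none ends there by [mC], and an arc that starts at or before
   [m] and ends beyond it leaves the window by the hypothesis on arcs over [m]. *)
have split_m : arc_count l x y = arc_count l x m + arc_count l m.+1 y.
  rewrite /arc_count.
  have: {subset l <= l} by []; elim: {1 3 4 5}l => [//|[e f] s IH] sl /=.
  rewrite IH => [|z zs]; last by apply: sl; rewrite inE zs orbT.
  have el := sl _ (mem_head _ _); have := over _ _ el; have /andP[] := arc_lt ld el.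
  have : f != m by apply: contraNneq mC => <-; apply/mapP; exists (e, f).
  lia.
(* For a cut beyond [m] the spare unit is the opener [a], which starts no arc inside [x, m); for
   [k <= m] it is the closer [m] itself. *)
rewrite split_m; have [mk|km] := ltnP m k.
  have := lb mk ky yn; have := @openersD closing x m k.
  have := @openersD closing m m.+1 k; have : arc_count l x m < openers closing x m.
    rewrite (arc_count_fst ld).
    rewrite -addn1 (_ : 1 = \sum_(x <= p < m) (p == a)); last first.
      rewrite (bigD1_seq a) ?mem_index_iota ?xa ?iota_uniq //= eqxx big1 //.
      by move=> i /negPf->.
    rewrite -big_split /=; rewrite /openers big_nat [X in _ <= X]big_nat.
    apply: leq_sum => p /andP[xp pm].
    case: eqP => [->|_]; rewrite ?addn0 ?ca.
      rewrite -[_ (~~ false)]add0n leq_add2r leqNgt -has_count.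
      apply/hasPn => -[e f] ef /=; apply/negP => /andP[/eqP ea fm]; subst.
      by have := ay _ ef; lia.
    apply: leq_trans (count_fst_le1 ld _ p) _; case: (boolP (p \in map fst l)) => // /mapP.
    by case=> -[e f] ef /= pe; rewrite pe (fst_not_closing ef) // -pe.
  lia.
have := lb xk km (ltnW mn); have := @lb m.+1 m.+1 y; rewrite openers_geq //.
have := @closersD closing k m y; have := @closersD closing m m.+1 y.
lia.
Qed.

Lemma raises_intro l' : arc_move l l' -> arc_diagram n l' ->
  (forall x y, arc_count l x y <= arc_count l' x y) ->
  (forall x k y, x <= k -> k <= y -> y <= n ->
     arc_count l x y < arc_count l' x y ->
     arc_count l' x y <= openers closing x k + closers closing k y) ->
  (exists x y, [/\ x <= n, y <= n & arc_count l x y < arc_count l' x y]) ->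
  raises l'.
Proof.
move=> mv d mono bd strict; split=> // x k y xk ky yn.
have [lt|ge] := ltnP (arc_count l x y) (arc_count l' x y); first exact: bd.
exact: leq_trans ge (lb xk ky yn).
Qed.

(** Pigeonhole. By the ballot condition at [m.+1] the openers before [m] outnumber the closers
    before [m], which are as many as the arcs inside [0, m). *)
Lemma exists_free_opener :
  exists a, [/\ a < m, ~~ closing a & forall b, (a, b) \in l -> m <= b].
Proof.
pose ind p := count (fun a => (a.1 == p) && (a.2 < m)) l.
have [/hasP[a]|/hasPn H] := boolP (has (fun a => ~~ closing a && (ind a == 0)) (iota 0 m)).
  rewrite mem_iota add0n => /= am /andP[ca /eqP ia]; exists a; split=> // b ab.
  rewrite leqNgt; apply/negP => bm; move: ia; apply/eqP; rewrite -lt0n -has_count.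
  by apply/hasP; exists (a, b); rewrite //= eqxx.
have : openers closing 0 m <= arc_count l 0 m.
  rewrite (arc_count_fst ld) /openers big_nat [X in _ <= X]big_nat.
  apply: leq_sum => p /andP[_ pm]; have /H : p \in iota 0 m by rewrite mem_iota.
  by rewrite negb_and negbK => /orP[->//|]; rewrite -lt0n; apply: leq_trans; case: (closing p).
rewrite -closers_prefix; have := ballot mn; rewrite closersS // openersS // closing_m /=.
lia.
Qed.

(** If arcs pass over [m], the one ending first is shortened to end at [m]; by minimality a window
    that gains from this contains no arc over [m]. If none does, a free opener is joined to [m]. *)
Lemma raise_unmatched : m \notin O -> exists l', raises l'.
Proof.
move=> mO.
have mpts : m \notin map fst l ++ map snd l by rewrite mem_cat negb_or mO.
pose over b := has (fun e => [&& e.1 < m, m < e.2 & e.2 == b]) l.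
have [[b0 ob0]|none] := pselect (exists b, over b).
  case: (ex_minnP (ex_intro over b0 ob0)) => b /hasP[[a b'] ab /and3P[/= am mb /eqP ?]] bmin.
  subst b'; have := arc_rem ab; set l0 := rem _ _ => p.
  have mv : arc_move l ((a, m) :: l0) by apply: (Move_close p); rewrite ?am.
  have abn := arc_lt ld ab.
  have cl x y : arc_count l x y = ((x <= a) && (b < y)) + arc_count l0 x y.
    by rewrite (arc_count_perm _ _ p).
  have cl' x y : arc_count ((a, m) :: l0) x y = ((x <= a) && (m < y)) + arc_count l0 x y by [].
  exists ((a, m) :: l0); apply: raises_intro => //.
  - apply: (arc_move_diagram ld) mv; rewrite /= mn.
    have /andP[+ _] := arc_diagram_perm p ld.
    by case/andP=> _; apply: sub_all => z /andP[].
  - by move=> x y; rewrite cl cl'; lia.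
  - move=> x k y xk ky yn; rewrite cl cl' => lt.
    have [xa my yb] : [/\ x <= a, m < y & y <= b] by split; lia.
    have : (arc_count l x y).+1 <= openers closing x k + closers closing k y.
      apply: (raise_window am (fst_not_closing ab am)) => // [c ac|e f ef em mf].
        by rewrite -(arc_fst_inj ld ab ac).
      apply: leq_trans yb _; apply: bmin; apply/hasP; exists (e, f) => //=.
      rewrite mf eqxx /= andbT ltn_neqAle em andbT; apply: contraNneq mO => <-.
      by apply/mapP; exists (e, f).
    by rewrite cl; lia.
  - by exists a, m.+1; rewrite cl cl'; split; lia.
have [a [am ca am']] := exists_free_opener.
have nover e f : (e, f) \in l -> e <= m -> m < f -> False.
  move=> ef em mf; case: none; exists f; apply/hasP; exists (e, f) => //=.
  rewrite mf eqxx /= andbT ltn_neqAle em andbT; apply: contraNneq mO => <-.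
  by apply/mapP; exists (e, f).
have aO b : (a, b) \in l -> False.
  move=> ab; apply: (nover _ _ ab); first exact: ltnW.
  rewrite ltn_neqAle am' // andbT; apply: contraNneq mC => ->.
  by apply/mapP; exists (a, b).
have mv : arc_move l ((a, m) :: l).
  apply: Move_add => //; rewrite mem_cat negb_or -agree // ca andbT.
  by apply/negP => /mapP[[a' b] ab /= ?]; subst a'; exact: (aO b).
have cl' x y : arc_count ((a, m) :: l) x y = ((x <= a) && (m < y)) + arc_count l x y by [].
exists ((a, m) :: l); apply: raises_intro => //.
- apply: (arc_move_diagram ld) mv; rewrite /= mn.
  by case/andP: ld => + _; apply: sub_all => z /andP[].
- by move=> x y; rewrite cl'; lia.
- move=> x k y xk ky yn; rewrite cl' => lt.
  have [xa my] : x <= a /\ m < y by lia.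
  have : (arc_count l x y).+1 <= openers closing x k + closers closing k y.
    apply: (raise_window am ca) => // [b /aO|e f ef em mf] //.
    by case: (nover _ _ ef em mf).
  by rewrite xa my.
- by exists a, m.+1; rewrite cl'; split; lia.
Qed.

Section Opener.
Variable b : nat.
Hypothesis mb : (m, b) \in l.

(** Moving the left end of (m, b) to the right adds an arc to windows [x, y) with [m < x] and
    [b < y]. A tight [x] starts such a window that has no room left. *)
Let tight x := [&& m < x, x <= b & [exists y : 'I_n.+1, [exists k : 'I_n.+1,
  [&& b < y, x <= k, k <= y & openers closing x k + closers closing k y <= arc_count l x y]]]].

(** The window consisting of [b] alone has bound 0: cut after [b] if [b] is a closer, before it
    otherwise. *)
Lemma exists_tight : exists x, tight x.
Proof.
have /andP[mb' bn] := arc_lt ld mb; exists b; rewrite /tight mb' leqnn /=.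
apply/existsP; exists (Ordinal (bn : b.+1 < n.+1)).
have [cb|cb] := boolP (closing b).
  apply/existsP; exists (Ordinal (bn : b.+1 < n.+1)) => /=.
  by rewrite !leqnn leqnSn openersS // openers_geq // closers_geq // cb.
apply/existsP; exists (Ordinal (ltnW bn : b < n.+1)) => /=.
by rewrite !leqnn leqnSn closersS // closers_geq // openers_geq // (negPf cb).
Qed.

(* If every point [f] between [m] and the first tight window were matched inside
   that window, counting openers and closers would violate the bound on the
   window [m, y0).  A free [f] can replace [m] as an opener of [b]. *)
Lemma raise_opener : exists l', raises l'.
Proof.
have /andP[mb' bn] := arc_lt ld mb.
case: (ex_minnP exists_tight) => x0 /and3P[mx0 x0b /existsP[[y0 /= y0n] /existsP[[k0 /= k0n]]]].
case/and4P => b_y0 xk0 ky0 tight0 x0min.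
have slack x k y : m < x -> x < x0 -> b < y -> y <= n -> x <= k -> k <= y ->
    arc_count l x y < openers closing x k + closers closing k y.
  move=> mx xx0 bY yn xk ky; rewrite ltnNge; apply/negP => t.
  have : x0 <= x; last by rewrite leqNgt xx0.
  apply: x0min; rewrite /tight mx (leq_trans (ltnW xx0) x0b) /=.
  apply/existsP; exists (Ordinal (yn : y < n.+1)).
  have kn : k < n.+1 by lia.
  by apply/existsP; exists (Ordinal kn); rewrite /= bY xk ky t.
pose opn f := count (fun a => (a.1 == f) && (a.2 < y0)) l.
pose cls f := count (fun a => (a.2 == f) && (m.+1 <= a.1)) l.
have [f [mf fx0 opf clf]] : exists f, [/\ m < f, f < x0, opn f = 0 & cls f = 0].
  have [/hasP[f]|/hasPn H] :=
      boolP (has (fun f => (opn f == 0) && (cls f == 0)) (index_iota m.+1 x0)).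
    by rewrite mem_index_iota => /andP[mf fx] /andP[/eqP o /eqP c]; exists f.
  have : \sum_(m.+1 <= f < x0) 1 <= \sum_(m.+1 <= f < x0) opn f + \sum_(m.+1 <= f < x0) cls f.
    rewrite -big_split /= big_nat [X in _ <= X]big_nat; apply: leq_sum => f fi.
    have /H : f \in index_iota m.+1 x0 by rewrite mem_index_iota.
    by lia.
  rewrite sum_nat_const_nat muln1 -(arc_count_snd ld) => le1.
  have := @lb m.+1 m.+1 x0; rewrite openers_geq // => /(_ (leqnn _) mx0) le2.
  have e1 : \sum_(m.+1 <= f < x0) opn f + arc_count l x0 y0 = arc_count l m.+1 y0.
    rewrite !(arc_count_fst ld) [RHS](@big_cat_nat _ _ _ x0) //=; lia.
  (* The surplus arc is (m, b): it lies in [m, y0), but its left end [m] is a closer and adds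
     nothing to the openers in the bound. *)
  have e2 : arc_count l m y0 = (arc_count l m.+1 y0).+1.
    rewrite !(arc_count_fst ld) big_ltn; last lia.
    rewrite -[RHS]add1n; congr (_ + _).
    apply/eqP; rewrite eqn_leq -has_count; apply/andP; split.
      by apply: leq_trans (count_fst_le1 ld _ m) _; case: (_ \in _).
    by apply/hasP; exists (m, b); rewrite //= eqxx.
  have := @lb m k0 y0; have := openers_closers closing m.+1 x0.
  have := @openersD closing m m.+1 k0; have := @openersD closing m.+1 x0 k0.
  have : openers closing m m.+1 = 0 by rewrite openersS // openers_geq // closing_m.
  lia.
pose over f := has (fun e => [&& e.1 < m, m < e.2, e.2 < x0 & e.2 == f]) l.
have diag l' : arc_move l l' -> all (fun a => a.2 < n) l' -> arc_diagram n l'.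
  by move=> mv h; apply: (arc_move_diagram ld) mv.
(* An arc (e, g) over [m] with [g < x0] crosses (m, b), and the two are uncrossed into (e, m) and
   (g, b). With the smallest [g], windows gaining (e, m) contain no arc over [m]; those gaining (g,
   b) start before [x0], where the bound is strict. *)
have [[f0 of0]|none] := pselect (exists f, over f).
  case: (ex_minnP (ex_intro over f0 of0)) => g /hasP[[e g'] eg /and4P[/= em mg gx0 /eqP ?]] gmin.
  subst g'.
  have ne : (e, g) != (m, b) by apply/eqP => -[? _]; subst; rewrite ltnn in em.
  have := perm_two_rem ne eg mb; set l0 := rem _ _ => p.
  have mv : arc_move l [:: (e, m), (g, b) & l0].
    by apply: (Move_uncross p); rewrite ?em //; lia.
  have cl x y : arc_count l x y =
      ((x <= e) && (g < y)) + (((x <= m) && (b < y)) + arc_count l0 x y).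
    by rewrite (arc_count_perm _ _ p).
  have cl' x y : arc_count [:: (e, m), (g, b) & l0] x y =
    ((x <= e) && (m < y)) + (((x <= g) && (b < y)) + arc_count l0 x y) by [].
  exists [:: (e, m), (g, b) & l0]; apply: raises_intro => //.
  - apply: diag mv _; rewrite /= mn bn.
    have /andP[/and3P[_ _ +] _] := arc_diagram_perm p ld.
    by apply: sub_all => z /andP[].
  - by move=> x y; rewrite cl cl'; lia.
  - move=> x k y xk ky yn lt.
    have step : arc_count [:: (e, m), (g, b) & l0] x y <= (arc_count l x y).+1.
      by rewrite cl cl'; lia.
    apply: leq_trans step _; rewrite cl cl' in lt.
    have [[xe my yg]|[mx xg bY]] :
      [/\ x <= e, m < y & y <= g] \/ [/\ m < x, x <= g & b < y].
    - have : (x <= e) && (m < y) && (y <= g) || (m < x) && (x <= g) && (b < y) by lia.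
      by case/orP=> /andP[/andP[]]; [left|right].
    - apply: (raise_window em (fst_not_closing eg em)) => // [c ec|e1 f1 ef1 e1m mf1].
        by rewrite -(arc_fst_inj ld eg ec).
      rewrite leqNgt; apply/negP => f1y.
      have: g <= f1; last by lia.
      apply: gmin; apply/hasP; exists (e1, f1) => //=; rewrite mf1 eqxx andbT.
      rewrite (_ : f1 < x0) ?andbT; last lia.
      rewrite ltn_neqAle e1m andbT; apply/eqP => e1m'; subst e1.
      by have := arc_fst_inj ld ef1 mb; lia.
    - by apply: slack => //; lia.
  - by exists e, m.+1; rewrite cl cl'; split; lia.
(* By the choice of [f], an arc ending there starts at or before [m]. It is not (m, b), which ends
   later, so it passes over [m] and ends before [x0]: the case just excluded. *)
have fC : f \notin C.
  apply/negP => /mapP[[e f'] ef /= ?]; subst f'.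
  have em : e <= m.
    rewrite leqNgt; apply/negP => me; move/eqP: clf; rewrite -leqn0 leqNgt -has_count.
    by case/negP; apply/hasP; exists (e, f); rewrite //= eqxx.
  have : e != m.
    by apply/eqP => ?; subst e; have := arc_fst_inj ld ef mb; lia.
  move=> ne; case: none; exists f; apply/hasP; exists (e, f) => //=.
  by rewrite ltn_neqAle ne em mf fx0 eqxx.
(* If [f] opens an arc, that arc ends at [y0] or later, hence crosses (m, b), and nesting the two
   produces (f, b). Otherwise [f] is free and replaces [m]. Either way the windows that gain start
   after [m] and before [x0]. *)
have [/mapP[[f' c] fc /= ?]|fO] := boolP (f \in O).
  subst f'.
  have y0c : y0 <= c.
    rewrite leqNgt; apply/negP => cy; move/eqP: opf; rewrite -leqn0 leqNgt -has_count.
    by case/negP; apply/hasP; exists (f, c); rewrite //= eqxx.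
  have ne : (m, b) != (f, c) by apply/eqP => -[? _]; subst; rewrite ltnn in mf.
  have := perm_two_rem ne mb fc; set l0 := rem _ _ => p.
  have mv : arc_move l [:: (m, c), (f, b) & l0].
    by apply: (Move_nest p); rewrite ?mf //; lia.
  have cl x y : arc_count l x y =
      ((x <= m) && (b < y)) + (((x <= f) && (c < y)) + arc_count l0 x y).
    by rewrite (arc_count_perm _ _ p).
  have cl' x y : arc_count [:: (m, c), (f, b) & l0] x y =
    ((x <= m) && (c < y)) + (((x <= f) && (b < y)) + arc_count l0 x y) by [].
  exists [:: (m, c), (f, b) & l0]; apply: raises_intro => //.
  - apply: diag mv _; rewrite /= bn; have /andP[_ ->] := arc_lt ld fc.
    have /andP[/and3P[_ _ +] _] := arc_diagram_perm p ld.
    by apply: sub_all => z /andP[].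
  - by move=> x y; rewrite cl cl'; lia.
  - move=> x k y xk ky yn lt.
    have step : arc_count [:: (m, c), (f, b) & l0] x y <= (arc_count l x y).+1.
      by rewrite cl cl'; lia.
    apply: leq_trans step _; rewrite cl cl' in lt.
    by apply: slack => //; lia.
  - by exists f, b.+1; rewrite cl cl'; split; lia.
have := arc_rem mb; set l0 := rem _ _ => p.
have mv : arc_move l ((f, b) :: l0).
  apply: (Move_open p); first by rewrite mf; lia.
  by rewrite mem_cat negb_or fC fO.
have cl x y : arc_count l x y = ((x <= m) && (b < y)) + arc_count l0 x y.
  by rewrite (arc_count_perm _ _ p).
have cl' x y : arc_count ((f, b) :: l0) x y = ((x <= f) && (b < y)) + arc_count l0 x y by [].
exists ((f, b) :: l0); apply: raises_intro => //.
- apply: diag mv _; rewrite /= bn.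
  have /andP[/andP[_ +] _] := arc_diagram_perm p ld.
  by apply: sub_all => z /andP[].
- by move=> x y; rewrite cl cl'; lia.
- move=> x k y xk ky yn lt.
  have step : arc_count ((f, b) :: l0) x y <= (arc_count l x y).+1 by rewrite cl cl'; lia.
  apply: leq_trans step _; rewrite cl cl' in lt.
  by apply: slack => //; lia.
- by exists f, b.+1; rewrite cl cl'; split; lia.
Qed.
End Opener.

Lemma raise_at : exists l', raises l'.
Proof.
have [/mapP[[m' b] mb /= ?]|] := boolP (m \in O); last exact: raise_unmatched.
by subst m'; apply: raise_opener mb.
Qed.
End Raise.

Lemma exists_raise closing n l :
  (forall m, m <= n -> closers closing 0 m <= openers closing 0 m) ->
  arc_diagram n l -> bounded_by closing n l ->
  (exists2 m, m <= n & arc_count l 0 m <> closers closing 0 m) ->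
  exists l', raises closing n l l'.
Proof.
move=> ballot ld lb [m0 m0n neq].
pose bad p := (p < n) && (closing p != (p \in map snd l)).
have [p badp] : exists p, bad p.
  have [/hasP[p]|/hasPn H] := boolP (has bad (iota 0 m0)); first by exists p.
  case: neq; rewrite (arc_count_prefix ld); apply: eq_big_nat => p /andP[_ pm].
  have := H p; rewrite mem_iota /bad (leq_trans pm m0n) => /(_ pm).
  by rewrite negbK => /eqP->.
case: (ex_minnP (ex_intro bad p badp)) => m /andP[mn mbad] mmin.
have agree q : q < m -> closing q = (q \in map snd l).
  move=> qm; apply/eqP; apply/negPn/negP => h.
  have: m <= q; last by rewrite leqNgt qm.
  by apply: mmin; rewrite /bad h (ltn_trans qm mn).
have pre : closers closing 0 m = arc_count l 0 m by exact: (closers_prefix ld agree).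
(* At the first discrepancy the cut [k = 0] on [0, m.+1) excludes a right end that is not closing;
   so [m] is closing and is no right end. *)
have := lb 0 0 m.+1 isT isT mn; rewrite openers_geq // closersS // pre.
rewrite !(arc_count_prefix ld) big_nat_recr //= add0n leq_add2l => le.
by apply: (raise_at ballot ld lb mn) => //; move: le mbad; case: (closing m); case: (_ \in _).
Qed.

(** * The arc diagram of a tableau *)

Lemma bigmax_seq_mem (s : seq nat) : s != [::] -> \max_(d <- s) d \in s.
Proof.
elim: s => [//|a [|b s] IH] _; first by rewrite big_seq1 mem_head.
rewrite big_cons inE; have := IH isT; set m := \max_(d <- b :: s) d => ms.
by case: (leqP a m) => _; rewrite ?eqxx // ms orbT.
Qed.

Lemma bigmax_seq_condP (s : seq nat) (P : pred nat) : has P s ->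
  [/\ P (\max_(d <- s | P d) d), \max_(d <- s | P d) d \in s
    & forall d, d \in s -> P d -> d <= \max_(d <- s | P d) d].
Proof.
move=> hs; have := @bigmax_seq_mem (filter P s); rewrite big_filter mem_filter.
rewrite -size_eq0 size_filter -lt0n -has_count hs => /(_ isT)/andP[Pm ms]; split=> // d ds Pd.
exact: (@leq_bigmax_seq _ s P id d).
Qed.

Section MatchCols.
Variable c1 : seq nat.
Hypothesis u1 : uniq c1.

(** The counting hypothesis leaves a candidate below each entry of [c2], so the maximum is attained
    instead of defaulting to 0. The last clause is the last-in-first-out rule: a candidate between
    [i] and [j] is skipped only if already taken. *)
Lemma match_colsP c2 used : sorted ltn c2 ->
  (forall s, s < size c2 -> size used + s < count (fun d => d < nth 0 c2 s) c1) ->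
  let l := match_cols c1 used c2 in
  [/\ map snd l = c2, forall i j, (i, j) \in l -> [/\ i \in c1, i < j & i \notin used],
      uniq (map fst l) &
      forall i j d, (i, j) \in l -> d \in c1 -> i < d < j ->
        d \in used \/ exists2 j', j' < j & (d, j') \in l].
Proof.
elim: c2 used => [|j c2 IH] used //= so H; rewrite -/(match_cols _ _ _).
set P := fun d => (d \notin used) && (d < j).
have hP : has P c1.
  apply/negPn/negP => /hasPn nP; have := H 0 isT; rewrite addn0 ltnNge => /negP; apply.
  rewrite -size_filter; apply: uniq_leq_size; first exact: filter_uniq.
  move=> d; rewrite mem_filter => /andP[/= dj dc]; have := nP _ dc.
  by rewrite /P dj andbT negbK.
have [Pi ic imax] := bigmax_seq_condP hP; move: Pi ic imax.
set i := (\max_(d <- c1 | _) d) => /andP[iu ij] ic imax.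
have so' : sorted ltn c2 by apply: path_sorted so.
have jc2 k : k \in c2 -> j < k.
  by move=> kc; move/(order_path_min ltn_trans)/allP: so => /(_ _ kc).
have [|e1 e2 e3 e4] := IH (i :: used) so'.
  by move=> s sc; have := H s.+1 sc; rewrite /= addnS.
split; first by rewrite e1.
- move=> i' j'; rewrite inE => /orP[/eqP[-> ->] //|/e2[? ?]].
  by rewrite inE negb_or => /andP[].
- rewrite e3 andbT; apply/negP => /mapP[[i' j'] /e2[_ _] + /= ii'].
  by rewrite -ii' mem_head.
- move=> i' j' d; rewrite inE => /orP[/eqP[-> ->]|ij'] dc /andP[id dj].
    left; apply/negPn/negP => du; have := imax d dc.
    by rewrite /P du dj leqNgt id => /(_ isT).
  have := e4 _ _ _ ij' dc; rewrite id dj => /(_ isT)[|[k kj kl]].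
    rewrite inE => /orP[/eqP->|]; last by left.
    right; exists j; last by rewrite mem_head.
    by apply: jc2; rewrite -e1; apply/mapP; exists (i', j').
  by right; exists k => //; rewrite inE kl orbT.
Qed.
End MatchCols.

Section Tableau.
Variables (n : nat) (T : tableau2 n).

(* The point [p] stands for the entry [p.+1]. *)
Definition closing p := p.+1 \in col2 T.
Definition sigma_arcs := [seq (a.1.-1, a.2.-1) | a <- sigma_cycles T].

Lemma col_mem t : (t \in col1 T ++ col2 T) = (0 < t <= n).
Proof. by rewrite (perm_mem (tab_entries T)) mem_iota addnC addn1 ltnS. Qed.

Lemma cols_uniq : uniq (col1 T ++ col2 T).
Proof. by rewrite (perm_uniq (tab_entries T)) iota_uniq. Qed.

Lemma col1_uniq : uniq (col1 T).
Proof. by have := cols_uniq; rewrite cat_uniq => /and3P[]. Qed.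

Lemma col2_uniq : uniq (col2 T).
Proof. by have := cols_uniq; rewrite cat_uniq => /and3P[]. Qed.

Lemma col1E t : (t \in col1 T) = (0 < t <= n) && (t \notin col2 T).
Proof.
have := cols_uniq; rewrite -col_mem mem_cat cat_uniq => /and3P[_ /hasPn h _].
by case: (boolP (t \in col2 T)) => [/h/negPf-> //|]; rewrite ?orbF ?andbT.
Qed.

Lemma col1_range t : t \in col1 T -> 0 < t <= n.
Proof. by rewrite col1E => /andP[]. Qed.

Lemma col2_range t : t \in col2 T -> 0 < t <= n.
Proof. by move=> tc; rewrite -col_mem mem_cat tc orbT. Qed.

Lemma count_leq_sum (s : seq nat) m : uniq s -> (forall t, t \in s -> 0 < t) ->
  count (fun t => t <= m) s = \sum_(0 <= p < m) (p.+1 \in s).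
Proof.
move=> us s0; have : perm_eq (filter (fun t => t <= m) s) (filter (fun t => t \in s) (iota 1 m)).
  apply: uniq_perm; rewrite ?filter_uniq ?iota_uniq // => t; rewrite !mem_filter mem_iota.
  rewrite add1n ltnS; case: (boolP (t \in s)) => [ts|]; last by rewrite andbF.
  by rewrite s0 // andbT.
move/perm_size; rewrite !size_filter => ->.
rewrite -(addn0 1) iotaDl count_map -sum1_count big_mkcond /index_iota subn0.
by apply: eq_bigr => p _; rewrite /= add1n; case: (_ \in _).
Qed.

Lemma count_col2 m : count (fun t => t <= m) (col2 T) = closers closing 0 m.
Proof. by apply: count_leq_sum col2_uniq _ => t /col2_range/andP[]. Qed.

Lemma count_col1 m : m <= n -> count (fun t => t <= m) (col1 T) = openers closing 0 m.
Proof.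
move=> mn; rewrite (count_leq_sum _ col1_uniq) => [|t /col1_range/andP[] //].
by apply: eq_big_nat => p /andP[_ pm]; rewrite col1E /= (leq_trans pm mn).
Qed.

Lemma subshapeE m : m <= n -> subshape T m = [:: openers closing 0 m; closers closing 0 m].
Proof. by move=> mn; rewrite /subshape count_col1 // count_col2. Qed.

Lemma shape2E : shape2 T = [:: openers closing 0 n; closers closing 0 n].
Proof.
rewrite /shape2 -count_col1 // -count_col2; congr [:: _; _]; apply/esym.
  by apply/eqP; rewrite -all_count; apply/allP => t /col1_range/andP[].
by apply/eqP; rewrite -all_count; apply/allP => t /col2_range/andP[].
Qed.

(** Rows increase: when the [s]-th entry of the second column is at most [m], so is the [s]-th entry
    of the first. *)
Lemma tableau_ballot m : m <= n -> closers closing 0 m <= openers closing 0 m.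
Proof.
move=> mn; rewrite -count_col1 // -count_col2 -!sum1_count.
rewrite [X in X <= _]big_mkcond [X in _ <= X]big_mkcond.
rewrite [X in X <= _](big_nth 0) [X in _ <= X](big_nth 0).
rewrite [X in _ <= X](@big_cat_nat _ _ _ (size (col2 T))) ?col_sizes //=.
apply: leq_trans (leq_addr _ _); rewrite big_nat [X in _ <= X]big_nat.
apply: leq_sum => s /andP[_ sc]; have := rows_increasing sc.
by move=> lt; case: ifP => // h; rewrite ifT //; apply: leq_trans (ltnW lt) h.
Qed.

(** The separately prescribed first pair obeys the general rule: below the least entry [j] of the
    second column all entries belong to the first, so the largest candidate is [j.-1]. *)
Lemma sigma_cyclesE : sigma_cycles T = match_cols (col1 T) [::] (col2 T).
Proof.
rewrite /sigma_cycles; case E : (col2 T) => [//|j c2] /=.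
suff <- : j.-1 = \max_(d <- col1 T | (d \notin [::]) && (d < j)) d by [].
have jn : 0 < j <= n by apply: col2_range; rewrite E mem_head.
have r0 : nth 0 (col1 T) 0 < j by have := @rows_increasing _ T 0; rewrite E; apply.
have s1 : 0 < size (col1 T) by apply: leq_trans (col_sizes T); rewrite E.
have a0 : 0 < nth 0 (col1 T) 0 by have /andP[] := col1_range (mem_nth 0 s1).
have jc : j.-1 \in col1 T.
  rewrite col1E; apply/andP; split; first lia.
  rewrite E inE negb_or; apply/andP; split; first lia.
  apply/negP => jc; have := col2_sorted T; rewrite E /= => /(order_path_min ltn_trans)/allP.
  by move/(_ _ jc) => /=; lia.
have P1 : (j.-1 \notin [::]) && (j.-1 < j) by rewrite in_nil /=; lia.
pose P d := (d \notin [::]) && (d < j).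
have hP : has P (col1 T) by apply/hasP; exists j.-1.
have [/andP[_ h1] _ h3] := bigmax_seq_condP hP.
have j0 : 0 < j by lia.
by apply/eqP; rewrite eqn_leq (h3 _ jc P1) -ltnS prednK.
Qed.

Lemma sigma_cyclesP : let l := sigma_cycles T in
  [/\ map snd l = col2 T, forall i j, (i, j) \in l -> i \in col1 T /\ i < j,
      uniq (map fst l) &
      forall i j d, (i, j) \in l -> d \in col1 T -> i < d < j ->
        exists2 j', j' < j & (d, j') \in l].
Proof.
rewrite sigma_cyclesE.
have [|e1 e2 e3 e4] := @match_colsP (col1 T) col1_uniq (col2 T) [::] (col2_sorted T).
  move=> s sc; rewrite add0n -sum1_count big_mkcond (big_nth 0).
  have sc1 : s < size (col1 T) by apply: leq_trans sc (col_sizes T).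
  rewrite (@big_cat_nat _ _ _ s.+1) //=; apply: leq_trans (leq_addr _ _).
  rewrite -[X in X <= _]muln1 -[X in X * _ <= _]subn0 -sum_nat_const_nat.
  rewrite big_nat [X in _ <= X]big_nat; apply: leq_sum => i /andP[_ si].
  rewrite ifT //; apply: leq_ltn_trans (rows_increasing sc).
  rewrite leq_eqVlt; move: si; rewrite ltnS leq_eqVlt => /orP[/eqP->|si]; first by rewrite eqxx.
  by rewrite (sorted_ltn_nth ltn_trans) ?orbT // ?col1_sorted // inE // (ltn_trans si).
split=> // [i j /e2[]|i j d ij dc idj] //.
by case: (e4 _ _ _ ij dc idj).
Qed.

Lemma sigma_arc_mem p q : ((p, q) \in sigma_arcs) = ((p.+1, q.+1) \in sigma_cycles T).
Proof.
have [e1 e2 _ _] := sigma_cyclesP; apply/mapP/idP => [[[i j] ij [-> ->]]|pq].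
  by have [/col1_range/andP[i0 _] lt] := e2 _ _ ij; rewrite !prednK //; lia.
by exists (p.+1, q.+1).
Qed.

Lemma sigma_arcP p q : (p, q) \in sigma_arcs -> [/\ p < q, q < n, ~~ closing p & closing q].
Proof.
rewrite sigma_arc_mem => pq; have [e1 e2 _ _] := sigma_cyclesP.
have [/[dup] pc] := e2 _ _ pq; rewrite col1E => /andP[_ pC] lt.
have qC : q.+1 \in col2 T by rewrite -e1; apply/mapP; exists (p.+1, q.+1).
by split=> //; have /andP[] := col2_range qC.
Qed.

Lemma sigma_arc_diagram : arc_diagram n sigma_arcs.
Proof.
have [e1 e2 e3 _] := sigma_cyclesP; apply: arc_diagramI.
  by apply/allP => -[p q] /sigma_arcP[] /= -> ->.
have -> : map fst sigma_arcs ++ map snd sigma_arcs =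
    map predn (map fst (sigma_cycles T) ++ col2 T).
  by rewrite map_cat -e1 -!map_comp.
have pos t : t \in map fst (sigma_cycles T) ++ col2 T -> 0 < t.
  rewrite mem_cat => /orP[/mapP[[i j] /e2[/col1_range/andP[]] //= i0 _ _ ->] //|].
  by move/col2_range/andP=> [].
rewrite map_inj_in_uniq => [|a b /pos a0 /pos b0 /= ab]; last lia.
rewrite cat_uniq e3 col2_uniq andbT /=; apply/hasPn => t tc.
apply/negP => /mapP[[i j] /e2[+ _] /= ti]; rewrite -ti col1E => /andP[_].
by rewrite tc.
Qed.

Lemma sigma_arc_lifo p q d : (p, q) \in sigma_arcs -> ~~ closing d -> p < d < q ->
  exists2 q', q' < q & (d, q') \in sigma_arcs.
Proof.
move=> pq dC pdq; have [_ _ _ e4] := sigma_cyclesP.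
have [_ qn _ _] := sigma_arcP pq.
have dc : d.+1 \in col1 T by rewrite col1E dC andbT; lia.
have := e4 p.+1 q.+1 d.+1; rewrite -sigma_arc_mem pq dc !ltnS => /(_ isT isT pdq).
case=> -[|q'] q'q; rewrite -?sigma_arc_mem; last by exists q'.
have [_ e2 _ _] := sigma_cyclesP.
by move/e2 => [_].
Qed.

Lemma closing_arc q : q < n -> closing q -> exists p, (p, q) \in sigma_arcs.
Proof.
move=> qn qC; have [e1 e2 _ _] := sigma_cyclesP.
move: qC; rewrite /closing -e1 => /mapP[[i j] ij /= qj].
have [/col1_range/andP[i0 _] _] := e2 _ _ ij.
by exists i.-1; rewrite sigma_arc_mem prednK // qj.
Qed.

(** An arc of [x, y) has its left end, an opener, in [x, k) or its right end, a closer, in [k,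
    y). *)
Lemma sigma_arcs_bounded : bounded_by closing n sigma_arcs.
Proof.
move=> x k y xk ky yn; have ld := sigma_arc_diagram.
pose P1 (a : nat * nat) := (x <= a.1) && (a.1 < k).
pose P2 (a : nat * nat) := (k <= a.2) && (a.2 < y).
have le12 : arc_count sigma_arcs x y <= count P1 sigma_arcs + count P2 sigma_arcs.
  rewrite -count_predUI; apply: leq_trans (leq_addr _ _).
  rewrite /arc_count; move: ld => /andP[/allP al _].
  rewrite -!size_filter; apply: size_subseq.
  have -> : filter (fun a => (x <= a.1) && (a.2 < y)) sigma_arcs =
     filter (fun a => (x <= a.1) && (a.2 < y)) (filter (predU P1 P2) sigma_arcs).
    rewrite -filter_predI; apply: eq_in_filter => -[p q] /al /= pq; rewrite /P1 /P2 /=.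
    case: (leqP x p) => //= xp; case: (ltnP q y) => //= qy.
    by rewrite andbT; case: (ltnP p k) => //= kp; symmetry; lia.
  exact: filter_subseq.
apply: leq_trans le12 _; apply: leq_add.
  rewrite -(@count_sum_eq sigma_arcs fst P1 x k) => [|//].
  rewrite /openers; apply: leq_sum => p _.
  apply: leq_trans (count_fst_le1 ld P1 p) _.
  case: (boolP (p \in _)) => // /mapP[[p' q] /sigma_arcP[_ _ + _] /= ->].
  by case: (closing _).
rewrite -(@count_sum_eq sigma_arcs snd P2 k y) => [|//].
rewrite /closers; apply: leq_sum => q _.
apply: leq_trans (count_snd_le1 ld P2 q) _.
case: (boolP (q \in _)) => // /mapP[[p q'] /sigma_arcP[_ _ _ +] /= ->].
by case: (closing _).
Qed.

(** The cut is placed just after the last closer [q] of the window whose arc starts before [x], or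
    at [x] if there is none. Closers beyond the cut are matched inside the window; openers in [x, q)
    are enclosed by the arc of [q], hence closed before [q]. *)
Lemma sigma_arcs_tight x y : x <= y -> y <= n ->
  exists k, [/\ x <= k, k <= y & openers closing x k + closers closing k y <= arc_count sigma_arcs x y].
Proof.
move=> xy yn; have ld := sigma_arc_diagram.
pose bad q := [&& x <= q, q < y & has (fun a => (a.2 == q) && (a.1 < x)) sigma_arcs].
have cl k : x <= k -> (forall q, k <= q -> ~~ bad q) ->
    closers closing k y <= \sum_(k <= q < y) count (fun a => (a.2 == q) && (x <= a.1)) sigma_arcs.
  move=> xk nb; rewrite /closers big_nat [X in _ <= X]big_nat; apply: leq_sum => q /andP[kq qy].
  case: (boolP (closing q)) => // qC; have [p pq] := closing_arc (leq_trans qy yn) qC.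
  rewrite -has_count; apply/hasP; exists (p, q); rewrite //= eqxx leqNgt /=.
  apply: contra (nb _ kq) => px; rewrite /bad (leq_trans xk kq) qy.
  by apply/hasP; exists (p, q); rewrite //= eqxx.
have [[q0 bq0]|nobad] := pselect (exists q, bad q); last first.
  exists x; split=> //; rewrite openers_geq // add0n (arc_count_snd ld); apply: cl => // q _.
  by apply/negP => bq; apply: nobad; exists q.
have bub q : bad q -> q <= y by case/and3P=> _ /ltnW.
case: (ex_maxnP (ex_intro bad q0 bq0) bub) => q bq qmax.
have /and3P[xq qy /hasP[[p q'] pq /= /andP[/eqP ? px]]] := bq; subst q'.
have [pltq qn pC qC] := sigma_arcP pq.
exists q.+1; split=> //; first exact: leqW.
rewrite (arc_count_snd ld) (@big_cat_nat _ _ _ q.+1) /=; [|lia|lia].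
apply: leq_add; last first.
  by apply: cl => [|q' qq']; [lia|apply/negP => /qmax; lia].
rewrite -(arc_count_snd ld) (arc_count_fst ld) /openers big_nat [X in _ <= X]big_nat.
apply: leq_sum => d /andP[xd dq]; case: (boolP (closing d)) => //= dC.
have dq' : d < q by rewrite ltn_neqAle -ltnS dq andbT; apply: contraNneq dC => ->.
have [|e eq de] := sigma_arc_lifo pq dC (d := d); first lia.
by rewrite -has_count; apply/hasP; exists (d, e); rewrite //= eqxx leqW.
Qed.

End Tableau.

Local Open Scope ring_scope.

(** * Nullstellensatz *)

Section PropIdeals.
Variable A : comNzRingType.
Implicit Types (P J : A -> Prop) (f g h : A).

Definition ring_ideal J :=
  [/\ J 0, forall f g, J f -> J g -> J (f + g) & forall h f, J f -> J (h * f)].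

Definition prime_ideal P :=
  [/\ ring_ideal P, ~ P 1 & forall f g, P (f * g) -> P f \/ P g].

Section Ideal.
Variable J : A -> Prop.
Hypothesis Ji : ring_ideal J.

Lemma ideal0 : J 0. Proof. by case: Ji. Qed.
Lemma idealD f g : J f -> J g -> J (f + g). Proof. by case: Ji => _ h _; apply: h. Qed.
Lemma idealM h f : J f -> J (h * f). Proof. by case: Ji => _ _; apply. Qed.
Lemma idealMr h f : J f -> J (f * h). Proof. by rewrite mulrC; apply: idealM. Qed.
Lemma idealN f : J f -> J (- f).
Proof. by rewrite -mulN1r; apply: idealM. Qed.
Lemma idealB f g : J f -> J g -> J (f - g).
Proof. by move=> Jf /idealN; apply: idealD. Qed.
Lemma ideal_sum (I : Type) (r : seq I) (Q : pred I) (F : I -> A) :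
  (forall i, Q i -> J (F i)) -> J (\sum_(i <- r | Q i) F i).
Proof.
by move=> H; apply: big_ind => //; [exact: ideal0|move=> f g; exact: idealD].
Qed.
End Ideal.

Lemma prime_exp P f k : prime_ideal P -> P (f ^+ k) -> P f.
Proof.
move=> [_ P1 Pm]; elim: k => [|k IH]; first by rewrite expr0.
by rewrite exprS => /Pm[].
Qed.

(* Zorn: an ideal maximal among those avoiding the powers of [f] is prime. *)
Lemma exists_prime_avoiding J f : ring_ideal J -> (forall k, ~ J (f ^+ k)) ->
  exists P, [/\ prime_ideal P, forall g, J g -> P g & ~ P f].
Proof.
move=> Ji Jf.
pose good B := [/\ ring_ideal B, forall g, J g -> B g & forall k, ~ B (f ^+ k)].
have [F Fgood Ftot|M [Mgood Mmax]] :=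
  @classical_sets.Zorn_bigcup A (fun B => B = classical_sets.set0 \/ good B).
  have [[B FB [b Bb]]|none] := pselect (exists2 B, F B & exists b, B b); last first.
    left; apply/predeqP => b; split=> // -[B FB Bb]; apply: none.
    by exists B => //; exists b.
  right; have gB C c : F C -> C c -> good C.
    by move=> /Fgood[->|].
  have [Bi BJ _] := gB _ _ FB Bb; split; first split.
  - by exists B => //; apply: ideal0.
  - move=> g h [C FC Cg] [D FD Dh].
    have [Ci _ _] := gB _ _ FC Cg; have [Di _ _] := gB _ _ FD Dh.
    have [CD|DC] := Ftot _ _ FC FD.
      by exists D => //; apply: idealD => //; apply: CD.
    by exists C => //; apply: idealD => //; apply: DC.
  - move=> h g [C FC Cg]; exists C => //; have [Ci _ _] := gB _ _ FC Cg.
    exact: idealM.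
  - by move=> g Jg; exists B => //; apply: BJ.
  - by move=> k [C FC Cf]; have [_ _ H] := gB _ _ FC Cf; apply: (H k Cf).
case: Mgood => [M0|[Mi MJ Mf]].
  case: (Mmax J); last by right.
  by rewrite M0; split=> [x []|/(_ _ (ideal0 Ji))[]].
have Mf1 : ~ M f by have := Mf 1%N; rewrite expr1.
exists M; split=> //; split=> //; first by have := Mf 0%N; rewrite expr0.
have ext g : ~ M g -> exists k a m, M m /\ f ^+ k = m + a * g.
  move=> Mg; pose N x := exists a m, M m /\ x = m + a * g.
  apply: contrapT => none; apply: (Mmax N); last first.
    right; split; first split.
    - by exists 0, 0; split; [exact: ideal0|ring].
    - move=> _ _ [a [m [Mm ->]]] [a' [m' [Mm' ->]]].
      by exists (a + a'), (m + m'); split; [exact: idealD|ring].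
    - move=> h _ [a [m [Mm ->]]].
      by exists (h * a), (h * m); split; [exact: idealM|ring].
    - by move=> h Jh; exists 0, h; split; [exact: MJ|ring].
    - by move=> k [a [m [Mm e]]]; apply: none; exists k, a, m.
  split=> [x Mx|NM]; first by exists 0, x; split=> //; ring.
  by apply: Mg; apply: NM; exists 1, 0; split; [exact: ideal0|ring].
move=> g h Mgh; apply: contrapT => /not_orP[/ext[k [a [m [Mm e]]]] /ext[k' [a' [m' [Mm' e']]]]].
apply: (Mf (k + k')%N); rewrite exprD e e'.
have -> : (m + a * g) * (m' + a' * h) = (m' + a' * h) * m + (a * g) * m' + (a * a') * (g * h) by ring.
by apply: (idealD Mi); [apply: (idealD Mi)|]; apply: (idealM Mi).
Qed.
End PropIdeals.

(** * Points of prime ideals after adjoining one variable *)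

Section PolyPoints.
Variables (K : closedFieldType).

(* The form of the Nullstellensatz that passes from [A] to [{poly A}]. *)
Definition has_points (A : comNzRingType) (iota : K -> A) :=
  forall (P : A -> Prop) c, prime_ideal P -> ~ P c ->
  exists ev : {rmorphism A -> K},
    [/\ cancel iota ev, forall p, P p -> ev p = 0 & ev c != 0].

Variables (A : idomainType) (iota : K -> A).
Hypothesis pointsA : has_points iota.

Section Prime.
Variables (P : {poly A} -> Prop) (c : {poly A}).
Hypotheses (Pp : prime_ideal P) (Pc : ~ P c).
Let Q a := P a%:P.

Let Pi : ring_ideal P. Proof. by case: Pp. Qed.

Let Qp : prime_ideal Q.
Proof.
case: Pp => _ P1 Pm; split=> [||f g]; rewrite /Q; last by rewrite polyCM => /Pm.
- split=> [|f g|h f]; rewrite ?polyC0 ?polyCD ?polyCM; [exact: ideal0|exact: idealD|exact: idealM].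
- by rewrite polyC1.
Qed.

Let Qi : ring_ideal Q. Proof. by case: Qp. Qed.

Let coef_in_Q (p : {poly A}) := forall i, Q p`_i.

Lemma coef_in_ideal p : coef_in_Q p -> P p.
Proof.
move=> H; rewrite -[p]coefK poly_def; apply: ideal_sum => // i _.
by rewrite -mul_polyC; apply: (idealMr Pi); apply: H.
Qed.

Definition drop_lead (p : {poly A}) := p - lead_coef p *: 'X^((size p).-1).

Lemma size_drop_lead p : p != 0 -> (size (drop_lead p) < size p)%N.
Proof.
move=> p0; have sp : (0 < size p)%N by rewrite size_poly_gt0.
rewrite -[X in (_ < X)%N](prednK sp) ltnS; apply/leq_sizeP => j.
rewrite leq_eqVlt /drop_lead coefB coefZ coefXn => /orP[/eqP<-|lt].
  by rewrite eqxx mulr1 subrr.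
by rewrite gtn_eqF // mulr0 subr0 nth_default // -(prednK sp).
Qed.

Lemma drop_lead_ideal p : Q (lead_coef p) -> P (p - drop_lead p).
Proof.
by move=> h; rewrite /drop_lead opprB addrC subrK -mul_polyC; apply: (idealMr Pi).
Qed.

(** A leading term whose coefficient is in [Q] lies in [P]; stripping it off leaves an element of
    [P] of smaller degree. *)
Lemma low_coef_in_Q m p :
  (forall h, P h -> (size h < m)%N -> Q (lead_coef h)) ->
  P p -> (size p < m)%N -> coef_in_Q p.
Proof.
move=> H; have [k] := ubnP (size p); elim: k p => // k IH p /ltnSE spk Pp' spm i.
have [->|p0] := eqVneq p 0; first by rewrite coef0; apply: (ideal0 Qi).
have Ql := H _ Pp' spm; have lt := size_drop_lead p0.
have Pd : P (drop_lead p).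
  by rewrite -[drop_lead p](subKr p); apply: idealB => //; apply: drop_lead_ideal.
have := IH _ (leq_trans lt spk) Pd (ltn_trans lt spm) i.
rewrite /drop_lead coefB coefZ coefXn => Qd.
rewrite -[p`_i](subrK (lead_coef p * (i == (size p).-1)%:R)).
by apply: (idealD Qi) => //; apply: (idealMr Qi).
Qed.

Lemma point_poly (ev : {rmorphism A -> K}) (x : K) : cancel iota ev ->
  (forall p, P p -> (map_poly ev p).[x] = 0) -> (map_poly ev c).[x] != 0 ->
  exists ev' : {rmorphism {poly A} -> K},
    [/\ cancel (polyC \o iota) ev', forall p, P p -> ev' p = 0 & ev' c != 0].
Proof.
move=> evK evP evc; exists (horner_eval x \o map_poly ev).
by split=> // z; rewrite /= /horner_eval map_polyC hornerC /= evK.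
Qed.

(** Here [P] is extended from [Q] and does not constrain the new variable: at a point of [A] where
    some coefficient of [c] survives, any non-root of the specialized [c] serves. *)
Lemma poly_point_const : (forall p, P p -> coef_in_Q p) ->
  exists ev' : {rmorphism {poly A} -> K},
    [/\ cancel (polyC \o iota) ev', forall p, P p -> ev' p = 0 & ev' c != 0].
Proof.
move=> H; have [i ci] : exists i, ~ Q c`_i.
  by apply/existsNP => /coef_in_ideal.
have [ev [evK evQ evc]] := pointsA Qp ci.
have : map_poly ev c != 0.
  by apply: contraNneq evc => /polyP/(_ i); rewrite coef_map coef0 => ->.
move/closed_nonrootP => [x]; rewrite rootE => cx; apply: (point_poly evK _ cx).
move=> p /H Qc; rewrite (_ : map_poly ev p = 0) ?horner0 //.
by apply/polyP => i'; rewrite coef_map coef0 /= evQ.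
Qed.

Import Pdiv.Idomain.

(* [g] has minimal degree in [P] outside [Q[X]], so modulo [Q] it generates [P]
   up to leading coefficients; [d] is a combination of [c] and [P] of minimal
   degree, hence a constant: at a root of [g] it keeps [c] from vanishing. *)
Lemma poly_point : exists ev' : {rmorphism {poly A} -> K},
    [/\ cancel (polyC \o iota) ev', forall p, P p -> ev' p = 0 & ev' c != 0].
Proof.
have [/poly_point_const//|/existsNP[p0 /not_implyP[Pp0 p0Q]]] :=
  pselect (forall p, P p -> coef_in_Q p).
pose inG m := `[< exists g, [/\ P g, ~ Q (lead_coef g) & size g = m] >].
have [m0 Gm0] : exists m, inG m.
  apply: contrapT => /forallNP none; apply: p0Q.
  apply: (@low_coef_in_Q (size p0).+1) => // h Ph _.
  by apply: contrapT => Qh; apply: (none (size h)); apply/asboolP; exists h.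
case: (ex_minnP (ex_intro inG m0 Gm0)) => m /asboolP[g [Pg Qg sg]] gmin.
have lowQ h : P h -> (size h < size g)%N -> coef_in_Q h.
  move=> Ph sh; apply: low_coef_in_Q Ph sh => h' Ph' sh'; apply: contrapT => Qh'.
  have : (m <= size h')%N by apply: gmin; apply/asboolP; exists h'.
  by rewrite -sg leqNgt sh'.
have expQ a k : ~ Q a -> ~ P (a ^+ k)%:P by move=> Qa /(prime_exp Qp).
have Pm f h : P (f * h) -> ~ P f -> P h by case: Pp => _ _ H /H[].
have g0 : g != 0 by apply: contra_notN Qg => /eqP->; rewrite lead_coef0; apply: ideal0 Qi.
have sg1 : (1 < size g)%N.
  rewrite ltn_neqAle eq_sym size_poly_gt0 g0 andbT; apply/eqP => /eqP/size_poly1P[a _ ga].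
  by apply: Qg; rewrite ga lead_coefC /Q -ga.
pose inD d := ~ P d /\ exists b, P (d - b * c).
pose inDm m := `[< exists2 d, inD d & size d = m >].
have [m1 Dm1] : exists m, inDm m.
  exists (size c); apply/asboolP; exists c => //; split=> //; exists 1.
  by rewrite mul1r subrr; apply: ideal0.
case: (ex_minnP (ex_intro inDm m1 Dm1)) => md /asboolP[d [Pd [b Pdb]] sd] dmin.
have {}dmin h : inD h -> (size d <= size h)%N.
  by move=> Dh; rewrite sd; apply: dmin; apply/asboolP; exists h.
have d0 : d != 0 by apply: contra_notN Pd => /eqP->; apply: ideal0.
have Qd : ~ Q (lead_coef d).
  move=> Ql; have : inD (drop_lead d).
    split=> [Pdl|].
      by apply: Pd; rewrite -[d](subrK (drop_lead d)); apply: idealD => //; apply: drop_lead_ideal.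
    exists b; rewrite (_ : _ - _ = (d - b * c) - (d - drop_lead d)); last by ring.
    by apply: idealB => //; apply: drop_lead_ideal.
  by move/dmin; rewrite leqNgt size_drop_lead.
(* The remainder of the pseudo-division of [c] by [g] competes with [d]: it is not in [P], for
   otherwise [P] would contain [c] times a power of the leading coefficient of [g]. *)
have sdg : (size d < size g)%N.
  apply: (@leq_ltn_trans (size (c %% g))); last by rewrite ltn_modp.
  have e := divp_eq c g; rewrite -mul_polyC in e; set l := lead_coef g ^+ _ in e.
  apply: dmin; split=> [Pr|].
    apply: Pc; apply: (Pm l%:P); last exact: expQ.
    by rewrite e; apply: idealD => //; apply: idealM.
  exists l%:P; rewrite (_ : _ - _ = - (c %/ g) * g); last by rewrite e; ring.
  exact: idealM.
(* If [d] is not constant, divide [g] by [d]: the remainder is in [P] by minimality of [d], hence so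
   is the quotient, [d] being outside [P]. Both have degree below that of [g], so their coefficients
   lie in [Q]; after cancelling a power of the leading coefficient of [d], so does that of [g]. *)
have sd1 : size d = 1%N.
  apply/eqP; rewrite eqn_leq size_poly_gt0 d0 andbT leqNgt; apply/negP => sd1.
  have e := divp_eq g d; rewrite -mul_polyC in e; set l := lead_coef d ^+ _ in e.
  have sr : (size (g %% d)%R < size d)%N by rewrite ltn_modp.
  have Pr : P (g %% d).
    apply: contrapT => Pr; have : inD (g %% d).
      split=> //; exists (- (g %/ d) * b).
      rewrite (_ : _ - _ = l%:P * g - (g %/ d) * (d - b * c)); last by rewrite e; ring.
      by apply: idealB => //; apply: idealM.
    by move/dmin; rewrite leqNgt sr.
  have Pq : P (g %/ d).
    apply: (Pm d) => //; rewrite mulrC (_ : _ * _ = l%:P * g - g %% d); last by rewrite e; ring.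
    by apply: idealB => //; apply: idealM.
  have sq : (size (g %/ d)%R < size g)%N.
    by rewrite size_divp // ltn_subrL size_poly_gt0 g0 -subn1 subn_gt0 sd1.
  have Ql : coef_in_Q (l%:P * g).
    rewrite e => i; rewrite coefD coefM; apply: (idealD Qi).
      by apply: (ideal_sum Qi) => j _; apply: (idealMr Qi); apply: lowQ.
    by apply: lowQ => //; apply: ltn_trans sdg.
  have := Ql (size g).-1; rewrite coefCM -lead_coefE => Qlg.
  by case: Qp => _ _ /(_ _ _ Qlg)[|//] /(prime_exp Qp).
have /size_poly1P[a a0 da] := introT eqP sd1.
have Qa : ~ Q a by rewrite /Q -da.
have Qag : ~ Q (a * lead_coef g) by case: Qp => _ _ Qm /Qm[].
have [ev [evK evQ evc]] := pointsA Qp Qag.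
move: evc; rewrite rmorphM mulf_eq0 negb_or => /andP[eva evg].
have [x /rootP gx] : exists x, root (map_poly ev g) x.
  apply/closed_rootP; rewrite size_map_poly_id0 //; by case: size sg1 => [|[]].
(* The leading coefficient of [g] survives under [ev], so pseudo-division by [g] passes the
   vanishing at the root [x] on to every [p] in [P]; the remainder has its coefficients in [Q]. *)
have evP p : P p -> (map_poly ev p).[x] = 0.
  move=> Pp'; have e := divp_eq p g; rewrite -mul_polyC in e; set l := lead_coef g ^+ _ in e.
  have Pr : P (p %% g).
    rewrite (_ : p %% g = l%:P * p - p %/ g * g); last by rewrite e; ring.
    by apply: idealB => //; apply: idealM.
  have r0 : map_poly ev (p %% g) = 0.
    by apply/polyP => i; rewrite coef_map coef0 /= evQ //; apply: lowQ; rewrite // ltn_modp.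
  have := congr1 (fun q => (map_poly ev q).[x]) e.
  rewrite rmorphD !rmorphM /= r0 map_polyC addr0 !hornerM hornerC gx mulr0 => h.
  have {h} : ev (lead_coef g) ^+ scalp p g * (map_poly ev p).[x] = 0.
    by rewrite -rmorphXn; exact: h.
  by move/eqP; rewrite mulf_eq0 expf_eq0 (negPf evg) andbF => /eqP.
apply: (point_poly evK evP); apply: contraNneq eva => cx.
have := evP _ Pdb; rewrite da rmorphB rmorphM /= map_polyC hornerD hornerN hornerM cx.
by rewrite mulr0 subr0 hornerC => ->.
Qed.
End Prime.

Lemma has_points_poly : has_points (polyC \o iota).
Proof. by move=> P c Pp Pc; apply: poly_point. Qed.
End PolyPoints.

Lemma mpoly_rmorph_ext n (R : comNzRingType) (S : nzRingType) (f g : {rmorphism {mpoly R[n]} -> S}) :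
  (forall c, f c%:MP = g c%:MP) -> (forall i, f 'X_i = g 'X_i) -> f =1 g.
Proof.
move=> fgC fgX; elim/mpolyind => [|c m p _ _ IH]; first by rewrite !rmorph0.
rewrite !rmorphD IH -mul_mpolyC !rmorphM fgC; congr (_ * _ + _).
rewrite mpolyXE_id !rmorph_prod; apply: eq_bigr => i _.
by rewrite !rmorphXn; congr (_ ^+ _); apply: fgX.
Qed.

Lemma prime_ideal_preim (A B : comNzRingType) (psi : {rmorphism A -> B}) (P : B -> Prop) :
  prime_ideal P -> prime_ideal (fun x => P (psi x)).
Proof.
case=> Pi P1 Pm; split=> [||f g]; rewrite ?rmorph1 ?rmorphM //; last exact: Pm.
split=> [|f g|h f]; rewrite ?rmorph0 ?rmorphD ?rmorphM.
- exact: ideal0.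
- exact: idealD.
- exact: idealM.
Qed.

Section MpolyPoints.
Variable K : closedFieldType.

Definition poly_to_mpoly n (q : {poly {mpoly K[n]}}) : {mpoly K[n.+1]} :=
  horner_eval 'X_ord_max (map_poly (@mwiden n K) q).

Lemma muniK n : cancel (@muni n K) (@poly_to_mpoly n).
Proof.
apply: (@mpoly_rmorph_ext _ _ _ (horner_eval 'X_ord_max \o map_poly (@mwiden n K) \o @muni n K) idfun).
  by move=> c /=; rewrite muniC map_polyC /horner_eval hornerC /= mwidenC.
move=> i /=; rewrite /muni mmapX mmap1U /=.
case: splitP => j e.
  rewrite map_polyC /horner_eval hornerC /= mwidenX mnmwiden1.
  by congr 'X__; apply/val_inj; rewrite /= -e.
rewrite map_polyX /horner_eval hornerX; congr 'X__; apply/val_inj => /=.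
by rewrite ord1 addn0 in e; symmetry; exact: e.
Qed.

(** Induction, with the last variable as polynomial variable: the prime is pulled back along [psi],
    and [psi (muni p) = p] carries the point back. Without variables, a proper ideal contains no
    nonzero constant. *)
Lemma has_points_mpoly n : has_points (@mpolyC n K).
Proof.
elim: n => [|n IH] P c Pp Pc; have [Pi P1 Pm] := Pp.
  exists (meval (fun _ => 0)); split=> [x|p Pp'|]; first by rewrite /= mevalC.
    apply/eqP; apply: contra_notT P1 => /=; rewrite [p]nvar0_mpolyC mevalC => p0.
    rewrite -mpolyC1 -(mulVf p0) mpolyCM; apply: (idealM Pi).
    by rewrite -nvar0_mpolyC.
  apply: contra_notN Pc => /=; rewrite {1}[c]nvar0_mpolyC mevalC => /eqP c0.
  by rewrite [c]nvar0_mpolyC c0 mpolyC0; exact: (ideal0 Pi).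
pose psi := horner_eval 'X_ord_max \o map_poly (@mwiden n K) : {rmorphism _ -> _}.
have psiK p : psi (muni p) = p by apply: muniK.
have Ppsi := prime_ideal_preim psi Pp.
have cpsi : ~ P (psi (muni c)) by rewrite psiK.
have [ev [evK evP evc]] := has_points_poly IH Ppsi cpsi.
exists (ev \o @muni n K); split=> // [x|p Pp'] /=.
  by rewrite muniC; apply: evK.
by apply: evP; rewrite psiK.
Qed.

Theorem nullstellensatz n (J : {mpoly K[n]} -> Prop) (f : {mpoly K[n]}) :
  ring_ideal J ->
  (forall x : 'I_n -> K, (forall g, J g -> g.@[x] = 0) -> f.@[x] = 0) ->
  exists k, J (f ^+ k).
Proof.
move=> Ji Jf; apply: contrapT => /forallNP nJ.
have [P [Pp JP Pf]] := exists_prime_avoiding Ji nJ.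
have [ev [evK evP evf]] := has_points_mpoly Pp Pf.
have evE p : p.@[fun i => ev 'X_i] = ev p.
  apply: (@mpoly_rmorph_ext _ _ _ (meval (fun i => ev 'X_i)) ev) => [c|i] /=.
    by rewrite mevalC; apply: esym; apply: evK.
  by rewrite mevalXU.
move: evf; rewrite -evE Jf ?eqxx // => g Jg; rewrite evE.
by apply: evP; apply: JP.
Qed.
End MpolyPoints.

(** * Windows of strictly upper triangular matrices *)

Section Windows.
Variables (K : fieldType) (n : nat).
Implicit Types (u v b c : 'M[K]_n) (l : seq (nat * nat)).

Definition row_cut x : 'M[K]_n := \matrix_(i, j) ((i == j) && (x <= i)%N)%:R.
Definition col_cut y : 'M[K]_n := \matrix_(i, j) ((i == j) && (i < y)%N)%:R.
(** Entries outside are set to zero while the size stays [n], so that windows are compared without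
    casts. For strictly upper [u], bounding the rows below by [x] and the columns above by [y]
    confines both to [x, y). *)
Definition win x y u := row_cut x *m u *m col_cut y.
Definition upper u := forall i j : 'I_n, (j < i)%N -> u i j = 0.
Definition strictly_upper u := forall i j : 'I_n, (j <= i)%N -> u i j = 0.

Lemma row_cutE m x (u : 'M[K]_(n, m)) i j : (row_cut x *m u) i j = (x <= i)%:R * u i j.
Proof.
rewrite mxE (bigD1 i) //= mxE eqxx big1 ?addr0 // => k /negPf ki.
by rewrite mxE eq_sym ki mul0r.
Qed.

Lemma col_cutE m y (u : 'M[K]_(m, n)) i j : (u *m col_cut y) i j = (j < y)%:R * u i j.
Proof.
rewrite mxE (bigD1 j) //= mxE eqxx big1 ?addr0 1?mulrC // => k /negPf kj.
by rewrite mxE kj mulr0.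
Qed.

Lemma row_cutEr m x (u : 'M[K]_(m, n)) i j : (u *m row_cut x) i j = (x <= j)%:R * u i j.
Proof.
rewrite mxE (bigD1 j) //= mxE eqxx big1 ?addr0 1?mulrC // => k /negPf kj.
by rewrite mxE kj mulr0.
Qed.

Lemma col_cutEl m y (u : 'M[K]_(n, m)) i j : (col_cut y *m u) i j = (i < y)%:R * u i j.
Proof.
rewrite mxE (bigD1 i) //= mxE eqxx big1 ?addr0 // => k /negPf ki.
by rewrite mxE eq_sym ki mul0r.
Qed.

Lemma winE x y u i j : win x y u i j = ((x <= i)%N && (j < y)%N)%:R * u i j.
Proof. by rewrite /win col_cutE row_cutE mulrA -natrM mulnb andbC. Qed.

Lemma win_full u : win 0 n u = u.
Proof. by apply/matrixP => i j; rewrite winE ltn_ord mul1r. Qed.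

Lemma upperM u v : upper u -> upper v -> upper (u *m v).
Proof.
move=> uu uv i j ji; rewrite mxE big1 // => k _.
have [ki|ik] := ltnP k i; first by rewrite uu ?mul0r.
by rewrite uv ?mulr0 // (leq_trans ji ik).
Qed.

Lemma strictly_upperW u : strictly_upper u -> upper u.
Proof. by move=> su i j /ltnW/su. Qed.

Lemma strictly_upperMl b u : upper b -> strictly_upper u -> strictly_upper (b *m u).
Proof.
move=> ub su i j ji; rewrite mxE big1 // => k _.
have [ki|ik] := ltnP k i; first by rewrite ub ?mul0r.
by rewrite su ?mulr0 // (leq_trans ji ik).
Qed.

Lemma strictly_upperMr b u : upper b -> strictly_upper u -> strictly_upper (u *m b).
Proof.
move=> ub su i j ji; rewrite mxE big1 // => k _.
have [ki|ik] := leqP k i; first by rewrite su ?mul0r.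
by rewrite ub ?mulr0 // (leq_ltn_trans ji ik).
Qed.

Lemma row_cut_upper x b : upper b -> row_cut x *m b = row_cut x *m b *m row_cut x.
Proof.
move=> ub; apply/matrixP => i j; rewrite row_cutEr row_cutE.
have [xi|] := leqP x i; last by rewrite mul0r mulr0.
have [xj|jx] := leqP x j; first by rewrite !mul1r.
by rewrite ub ?mulr0 // (leq_trans jx xi).
Qed.

Lemma col_cut_upper y b : upper b -> b *m col_cut y = col_cut y *m (b *m col_cut y).
Proof.
move=> ub; apply/matrixP => i j; rewrite col_cutEl col_cutE.
have [iy|yi] := ltnP i y; first by rewrite mul1r.
have [jy|_] := ltnP j y; last by rewrite mul0r mulr0.
by rewrite ub ?mulr0 // (leq_trans jy yi).
Qed.

Definition tri_unit b := upper b /\ exists2 c, upper c & b *m c = 1%:M /\ c *m b = 1%:M.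

Lemma tri_unitM b c : tri_unit b -> tri_unit c -> tri_unit (b *m c).
Proof.
move=> [ub [b' ub' [bb' b'b]]] [uc [c' uc' [cc' c'c]]]; split; first exact: upperM.
exists (c' *m b'); first exact: upperM; split.
  by rewrite mulmxA -(mulmxA b) cc' mulmx1.
by rewrite mulmxA -(mulmxA c') b'b mulmx1.
Qed.

Lemma tri_unit1 : tri_unit 1%:M.
Proof.
have u1 : upper 1%:M by move=> i j ji; rewrite mxE -val_eqE gtn_eqF.
by split=> //; exists 1%:M; rewrite ?mulmx1.
Qed.

(** A row cut absorbs an upper triangular factor on its right, a column cut one on its left; so the
    window of the product is a product containing the window of [u]. *)
Lemma rank_win_le b u c x y : upper b -> upper c ->
  (\rank (win x y (b *m u *m c)) <= \rank (win x y u))%N.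
Proof.
move=> ub uc; have -> : win x y (b *m u *m c) =
    row_cut x *m b *m win x y u *m (c *m col_cut y).
  rewrite /win -!mulmxA (mulmxA (row_cut x) b) (mulmxA (col_cut y) c) -(mulmxA (col_cut y)).
  by rewrite -(col_cut_upper y uc) (row_cut_upper x ub) -!mulmxA.
by rewrite (leq_trans (mxrankM_maxl _ _)) // mxrankM_maxr.
Qed.

Lemma rank_win_tri b u c x y : tri_unit b -> tri_unit c ->
  \rank (win x y (b *m u *m c)) = \rank (win x y u).
Proof.
move=> [ub [b' ub' [bb' b'b]]] [uc [c' uc' [cc' c'c]]]; apply/eqP.
rewrite eqn_leq rank_win_le //=.
have {1}-> : u = b' *m (b *m u *m c) *m c'.
  by rewrite -mulmxA -(mulmxA (b *m u)) cc' mulmx1 mulmxA b'b mul1mx.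
exact: rank_win_le.
Qed.

Definition col_op q (w : 'cV[K]_n) : 'M[K]_n := 1%:M + w *m (\row_j (j == q :> nat)%:R).

(** Sherman-Morrison: the square of the rank-one matrix [w *m r] is [w q 0] times itself, which
    gives the inverse. *)
Lemma col_op_unit (q : 'I_n) (w : 'cV[K]_n) : (forall i : 'I_n, (q < i)%N -> w i 0 = 0) ->
  1 + w q 0 != 0 -> tri_unit (col_op q w).
Proof.
move=> wq w1.
have up (w' : 'cV[K]_n) : (forall i : 'I_n, (q < i)%N -> w' i 0 = 0) -> upper (col_op q w').
  move=> h i j ji; rewrite !mxE big_ord1 !mxE -val_eqE gtn_eqF // add0r.
  by have [jq|_] := eqVneq (j : nat) q; rewrite ?mulr0 // h ?mul0r // -jq.
split; first exact: up.
pose r : 'rV[K]_n := \row_j (j == q :> nat)%:R.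
have rw : r *m w = (w q 0)%:M.
  apply/matrixP => i j; rewrite !ord1 !mxE eqxx mulr1n (bigD1 q) //= mxE eqxx mul1r.
  by rewrite big1 ?addr0 // => k kq; rewrite mxE (negPf (kq : (k != q :> nat))) mul0r.
have mul a t : (1%:M + a *: (w *m r)) *m (1%:M + t *: (w *m r)) =
    1%:M + (a + t + a * t * w q 0) *: (w *m r).
  have e : w *m r *m (w *m r) = w q 0 *: (w *m r).
    by rewrite -mulmxA (mulmxA r) rw mul_scalar_mx -scalemxAr.
  rewrite mulmxDl mul1mx mulmxDr mulmx1 -scalemxAl -scalemxAr e !scalerA -!addrA; congr (_ + _).
  by rewrite -!scalerDl; congr (_ *: _); ring.
exists (col_op q ((- (1 + w q 0)^-1) *: w)).
  by apply: up => i qi; rewrite mxE (wq _ qi) mulr0.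
have -> : col_op q w = 1%:M + 1 *: (w *m r) by rewrite scale1r.
have -> : col_op q ((- (1 + w q 0)^-1) *: w) = 1%:M + (- (1 + w q 0)^-1) *: (w *m r).
  by rewrite /col_op -scalemxAl.
by rewrite !mul; split; rewrite -[RHS]addr0; congr (_ + _);
  rewrite -[RHS](scale0r (w *m r)); congr (_ *: _); field.
Qed.
End Windows.

(** * Matrices of arc diagrams *)

Section ArcMatrices.
Variables (K : fieldType) (n : nat).
Implicit Types (u v : 'M[K]_n) (l : seq (nat * nat)) (p q r s : nat).

Definition unit_entry p q : 'M[K]_n :=
  \matrix_(i, j) ((i == p :> nat) && (j == q :> nat))%:R.
Local Notation E := unit_entry.

Definition arc_mx l := \sum_(a <- l) E a.1 a.2.

Lemma unit_entryM p q r s : (q < n)%N -> E p q *m E r s = (q == r)%:R *: E p s.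
Proof.
move=> qn; apply/matrixP => i j; rewrite !mxE (bigD1 (Ordinal qn)) //= big1 => [|k kq].
  by rewrite !mxE /= eqxx; case: (i == p :> nat); case: (q == r); case: (j == s :> nat);
    rewrite /= ?addr0; ring.
by rewrite !mxE (negPf (kq : (k != q :> nat))) andbF mul0r.
Qed.

Lemma arc_mxMr l p q : all (fun a => a.2 < n)%N l -> p \notin map snd l ->
  arc_mx l *m E p q = 0.
Proof.
move=> /allP ln pl; rewrite /arc_mx mulmx_suml big_seq big1 // => a al.
rewrite unit_entryM ?ln //; case: eqP => [ap|]; last by rewrite scale0r.
by case/negP: pl; apply/mapP; exists a.
Qed.

Lemma arc_mxMl l p q : (q < n)%N -> q \notin map fst l -> E p q *m arc_mx l = 0.
Proof.
move=> qn ql; rewrite /arc_mx mulmx_sumr big_seq big1 // => a al.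
rewrite unit_entryM //; case: eqP => [aq|]; last by rewrite scale0r.
by case/negP: ql; apply/mapP; exists a.
Qed.

Lemma arc_mx_cons a l : arc_mx (a :: l) = E a.1 a.2 + arc_mx l.
Proof. by rewrite /arc_mx big_cons. Qed.

Lemma arc_mx_perm l l' : perm_eq l l' -> arc_mx l = arc_mx l'.
Proof. by move=> p; rewrite /arc_mx (perm_big _ p). Qed.

Lemma arc_mx_sq l : arc_diagram n l -> arc_mx l *m arc_mx l = 0.
Proof.
move=> ld; rewrite {2}/arc_mx mulmx_sumr big_seq big1 // => -[p q] pl.
rewrite arc_mxMr //=.
  by apply/allP => -[x y] /(arc_lt ld)/andP[].
by apply/negP => /mapP[[p' q'] pq' /= pp]; subst; exact: (arc_disjoint ld pl pq').
Qed.

Lemma unit_entry_strict p q : (p < q)%N -> strictly_upper (E p q).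
Proof. by move=> pq i j ji; rewrite mxE; case: eqP => //= ip; case: eqP => // jq; lia. Qed.

Lemma arc_mx_strict l : arc_diagram n l -> strictly_upper (arc_mx l).
Proof.
move=> ld i j ji; rewrite summxE big_seq big1 // => -[p q] /(arc_lt ld)/andP[pq _].
exact: unit_entry_strict.
Qed.

Lemma strictly_upperD u v : strictly_upper u -> strictly_upper v -> strictly_upper (u + v).
Proof. by move=> su sv i j ji; rewrite mxE su // sv // addr0. Qed.

Lemma strictly_upperZ (x : K) u : strictly_upper u -> strictly_upper (x *: u).
Proof. by move=> su i j ji; rewrite mxE su // mulr0. Qed.

(** Left ends are distinct and so are right ends, hence the matrix is [U^T *m V] where [U] and [V]
    have orthonormal rows. *)
Lemma rank_arc_mx l : arc_diagram n l -> \rank (arc_mx l) = size l.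
Proof.
move=> ld; have ln i : (i < size l)%N -> ((nth (0, 0)%N l i).1 < (nth (0, 0)%N l i).2 < n)%N.
  by case: (nth _ _ _) (@mem_nth _ (0, 0)%N l i) => p q /[swap] il /(_ il) /(arc_lt ld).
pose U : 'M[K]_(size l, n) := \matrix_(i, j) (j == (nth (0, 0)%N l i).1 :> nat)%:R.
pose V : 'M[K]_(size l, n) := \matrix_(i, j) (j == (nth (0, 0)%N l i).2 :> nat)%:R.
have eUV : arc_mx l = U^T *m V.
  apply/matrixP => i j; rewrite /arc_mx (big_nth (0, 0)%N) big_mkord summxE mxE.
  by apply: eq_bigr => k _; rewrite !mxE -natrM mulnb.
move: (arc_diagram_uniq ld); rewrite cat_uniq => /and3P[u1 _ u2].
have nthi (f : nat * nat -> nat) (i j : 'I_(size l)) : uniq (map f l) ->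
    (f (nth (0, 0)%N l i) == f (nth (0, 0)%N l j)) = (i == j).
  by move=> uf; rewrite -!(nth_map _ 0%N) // nth_uniq ?size_map.
have UU : U *m U^T = 1%:M.
  apply/matrixP => i j; rewrite !mxE.
  have /andP[a1 a2] := ln _ (ltn_ord i).
  rewrite (bigD1 (Ordinal (ltn_trans a1 a2))) //= !mxE eqxx mul1r (nthi fst) // big1 ?addr0 //.
  by move=> k /negPf ki; rewrite !mxE (ki : (k == _ :> nat) = _) mul0r.
have VV : V *m V^T = 1%:M.
  apply/matrixP => i j; rewrite !mxE.
  have /andP[a1 a2] := ln _ (ltn_ord i).
  rewrite (bigD1 (Ordinal a2)) //= !mxE eqxx mul1r (nthi snd) // big1 ?addr0 //.
  by move=> k /negPf ki; rewrite !mxE (ki : (k == _ :> nat) = _) mul0r.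
apply/eqP; rewrite eqn_leq; apply/andP; split.
  by rewrite eUV (leq_trans (mxrankM_maxr _ _)) // rank_leq_row.
have : U *m arc_mx l *m V^T = 1%:M by rewrite eUV mulmxA UU mul1mx VV.
move/(congr1 mxrank); rewrite mxrank1 => <-.
by rewrite (leq_trans (mxrankM_maxl _ _)) // mxrankM_maxr.
Qed.

Lemma win_arc_mx l x y : arc_diagram n l ->
  win x y (arc_mx l) = arc_mx [seq a <- l | (x <= a.1) && (a.2 < y)]%N.
Proof.
move=> ld; apply/matrixP => i j; rewrite winE /arc_mx !summxE big_filter mulr_sumr.
rewrite [RHS]big_mkcond; apply: eq_bigr => a _; rewrite !mxE.
case: eqP => [->|_]; last by rewrite /= mulr0; case: ifP.
case: eqP => [->|_]; last by rewrite /= mulr0; case: ifP.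
by rewrite mulr1; case: ifP.
Qed.

Lemma rank_win_arc_mx l x y : arc_diagram n l ->
  \rank (win x y (arc_mx l)) = arc_count l x y.
Proof.
move=> ld; rewrite win_arc_mx // rank_arc_mx ?size_filter //.
case/andP: ld => al u; apply: arc_diagramI.
  by rewrite all_filter; apply: sub_all al => a /= ->; rewrite implybT.
apply: subseq_uniq u; apply: cat_subseq; apply: map_subseq; exact: filter_subseq.
Qed.

Lemma elem_unit p q (x : K) : (p <= q)%N -> (q < n)%N -> (p = q -> 1 + x != 0) ->
  tri_unit (1%:M + x *: E p q).
Proof.
move=> pq qn x1; pose w : 'cV[K]_n := \col_i (x * (i == p :> nat)%:R).
have -> : 1%:M + x *: E p q = col_op q w.
  rewrite /col_op; congr (_ + _); apply/matrixP => i j.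
  by rewrite !mxE big_ord1 !mxE -mulrA -natrM mulnb.
apply: (@col_op_unit _ _ (Ordinal qn)) => [i /= qi|].
  by rewrite mxE gtn_eqF ?mulr0 //; lia.
rewrite mxE /=; have [qp|_] := eqVneq q p; first by rewrite mulr1 x1.
by rewrite /= mulr0 addr0 oner_neq0.
Qed.
End ArcMatrices.

(** * Lines realizing the arc moves; [N] is the matrix of the untouched arcs, [S] contains the
    points that move *)

Section Lines.
Variables (K : fieldType) (n : nat) (N : 'M[K]_n) (S : seq nat).
Local Notation E := (unit_entry K n).

(* The line [N + t M] has the rank profile of [N'] outside [t = 0]. *)
Definition raising_line (N' N M : 'M[K]_n) := forall t, t != 0 ->
  [/\ strictly_upper (N + t *: M), (N + t *: M) *m (N + t *: M) = 0
    & exists b c, [/\ tri_unit b, tri_unit c & N + t *: M = b *m N' *m c]].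

Hypotheses (sN : strictly_upper N) (NN : N *m N = 0).
Hypothesis NE : forall p q, p \in S -> N *m E p q = 0.
Hypothesis EN : forall p q, q \in S -> (p < n)%N -> (q < n)%N -> E p q *m N = 0.

Local Ltac expand := rewrite ?(mulmxDl, mulmxDr, mul1mx, mulmx1);
  repeat rewrite -?scalemxAl -?scalemxAr.
Local Ltac finish := rewrite ?(scale1r, scale0r, scaler0);
  repeat match goal with |- context [E ?p ?q] => generalize (E p q); intro end;
  apply/matrixP => i j; rewrite !mxE.

Lemma scale_last (X : 'M[K]_n) p q t : (q < n)%N -> X *m E q q = 0 ->
  (E p q + X) *m (1%:M + (t - 1) *: E q q) = t *: E p q + X.
Proof.
move=> qn XE; rewrite mulmxDr mulmx1 mulmxDl -!scalemxAr XE unit_entryM // eqxx scale1r.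
by finish; ring.
Qed.

Lemma scale_unit q t : (q < n)%N -> t != 0 -> tri_unit (1%:M + (t - 1) *: E q q).
Proof. by move=> qn t0; apply: elem_unit => // _; rewrite addrCA subrr addr0. Qed.

Lemma line_add a b : (a < b)%N -> (b < n)%N -> {subset [:: a; b] <= S} ->
  raising_line (E a b + N) N (E a b).
Proof.
move=> ab bn sS t t0; have an := ltn_trans ab bn.
have [aS bS] : a \in S /\ b \in S by split; apply: sS; rewrite !inE eqxx ?orbT.
split.
- by apply: strictly_upperD => //; apply: strictly_upperZ; apply: unit_entry_strict.
- expand; rewrite NN NE // EN // unit_entryM // (gtn_eqF ab).
  by rewrite !(scale0r, scaler0, addr0).
exists 1%:M, (1%:M + (t - 1) *: E b b); split; [exact: tri_unit1|exact: scale_unit|].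
by rewrite mul1mx scale_last ?NE // addrC.
Qed.

Lemma line_close a m b : (a < m)%N -> (m < b)%N -> (b < n)%N -> {subset [:: a; m; b] <= S} ->
  raising_line (E a m + N) (E a b + N) (E a m).
Proof.
move=> am mb bn sS t t0; have mn := ltn_trans mb bn; have an := ltn_trans am mn.
have [aS mS bS] : [/\ a \in S, m \in S & b \in S].
  by split; apply: sS; rewrite !inE eqxx ?orbT.
have ab := ltn_trans am mb.
split.
- apply: strictly_upperD; last by apply: strictly_upperZ; apply: unit_entry_strict.
  by apply: strictly_upperD => //; apply: unit_entry_strict.
- expand; rewrite NN !NE // !EN // !unit_entryM // (gtn_eqF am) (gtn_eqF ab).
  by rewrite !(scale0r, scaler0, addr0).
(* Column [m] is scaled by [t]; adding [t^-1] times it to column [b] restores the old arc (a, b). *)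
exists 1%:M, ((1%:M + (t - 1) *: E m m) *m (1%:M + t^-1 *: E m b)); split.
- exact: tri_unit1.
- by apply: tri_unitM; [exact: scale_unit|apply: elem_unit => //; lia].
rewrite mul1mx mulmxA scale_last ?NE //; expand.
by rewrite NE // unit_entryM // eqxx; finish; field.
Qed.

Lemma line_open m f b : (m < f)%N -> (f < b)%N -> (b < n)%N -> {subset [:: m; f; b] <= S} ->
  raising_line (E f b + N) (E m b + N) (E f b).
Proof.
move=> mf fb bn sS t t0; have fn := ltn_trans fb bn; have mn := ltn_trans mf fn.
have [mS fS bS] : [/\ m \in S, f \in S & b \in S].
  by split; apply: sS; rewrite !inE eqxx ?orbT.
have mb := ltn_trans mf fb.
split.
- apply: strictly_upperD; last by apply: strictly_upperZ; apply: unit_entry_strict.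
  by apply: strictly_upperD => //; apply: unit_entry_strict.
- expand; rewrite NN !NE // !EN // !unit_entryM // (gtn_eqF mb) (gtn_eqF fb).
  by rewrite !(scale0r, scaler0, addr0).
exists (1%:M + t^-1 *: E m f), (1%:M + (t - 1) *: E b b); split.
- by apply: elem_unit => //; lia.
- exact: scale_unit.
rewrite -mulmxA scale_last ?NE //; expand.
by rewrite EN // unit_entryM // eqxx; finish; field.
Qed.

Lemma line_nest a b c d : (a < b)%N -> (b < c)%N -> (c < d)%N -> (d < n)%N ->
  {subset [:: a; b; c; d] <= S} ->
  raising_line (E a d + (E b c + N)) (E a c + (E b d + N)) (E b c).
Proof.
move=> ab bc cd dn sS t t0.
have cn := ltn_trans cd dn; have bn := ltn_trans bc cn; have an := ltn_trans ab bn.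
have [aS bS cS dS] : [/\ a \in S, b \in S, c \in S & d \in S].
  by split; apply: sS; rewrite !inE eqxx ?orbT.
have ac := ltn_trans ab bc; have bd := ltn_trans bc cd; have ad := ltn_trans ac cd.
split.
- apply: strictly_upperD; last by apply: strictly_upperZ; apply: unit_entry_strict.
  by do 2! [apply: strictly_upperD => //; first exact: unit_entry_strict].
- expand; rewrite NN !NE // !EN // !unit_entryM //.
  rewrite (gtn_eqF ac) (gtn_eqF bc) (gtn_eqF bd) (gtn_eqF ad).
  by rewrite !(scale0r, scaler0, addr0).
(* Adding [t^-1] times row [b] to row [a] creates, besides (a, c), the entry [t^-1] at (a, d). The
   scaling of column [d] by [- t^-1] is chosen to cancel it. *)
have t1 : - t^-1 != 0 by rewrite oppr_eq0 invr_eq0.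
exists (1%:M + t^-1 *: E a b), ((1%:M + (t - 1) *: E c c) *m (1%:M + (- t^-1 - 1) *: E d d)
  *m (1%:M + t^-1 *: E c d)); split.
- by apply: elem_unit => //; lia.
- by apply: tri_unitM; [apply: tri_unitM; exact: scale_unit|apply: elem_unit => //; lia].
rewrite -mulmxA !(mulmxA (E a d + _)) (addrCA (E a d)) (@scale_last _ _ c _ cn); last first.
  by expand; rewrite NE // unit_entryM // (gtn_eqF cd) scale0r addr0.
rewrite (addrCA (t *: E b c)) (@scale_last _ _ d _ dn); last first.
  by expand; rewrite NE // unit_entryM // (ltn_eqF cd) scale0r scaler0 addr0.
have -> : (- t^-1 *: E a d + (t *: E b c + N)) *m (1%:M + t^-1 *: E c d) =
    (- t^-1) *: E a d + (t *: E b c + N) + E b d.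
  by expand; rewrite NE // !unit_entryM // eqxx (gtn_eqF cd); finish; field.
expand; rewrite EN // !unit_entryM // eqxx (gtn_eqF ab).
by finish; field.
Qed.

(** The direction needs both terms for the square to stay zero: [E a b] composes with the arc (b,
    d), and the sign of [- E c d] makes its product with the arc (a, c) cancel this. *)
Lemma line_uncross a b c d : (a < b)%N -> (b < c)%N -> (c < d)%N -> (d < n)%N ->
  {subset [:: a; b; c; d] <= S} ->
  raising_line (E a b + (E c d + N)) (E a c + (E b d + N)) (E a b - E c d).
Proof.
move=> ab bc cd dn sS t t0.
have cn := ltn_trans cd dn; have bn := ltn_trans bc cn; have an := ltn_trans ab bn.
have [aS bS cS dS] : [/\ a \in S, b \in S, c \in S & d \in S].
  by split; apply: sS; rewrite !inE eqxx ?orbT.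
have ac := ltn_trans ab bc; have bd := ltn_trans bc cd; have ad := ltn_trans ac cd.
split.
- apply: strictly_upperD.
    by do 2! [apply: strictly_upperD => //; first exact: unit_entry_strict].
  rewrite scalerBr -scaleNr.
  by apply: strictly_upperD; apply: strictly_upperZ; apply: unit_entry_strict.
- rewrite scalerBr -scaleNr; expand; rewrite NN !NE // !EN // !unit_entryM // !eqxx.
  rewrite (gtn_eqF ac) (gtn_eqF bc) (ltn_eqF bc) (gtn_eqF bd) (gtn_eqF ad) (gtn_eqF ab) (gtn_eqF cd).
  by finish; ring.
have t1 : - t != 0 by rewrite oppr_eq0.
exists (1%:M - t^-1 *: E b c), ((1%:M + (t - 1) *: E b b) *m (1%:M + (- t - 1) *: E d d)
  *m (1%:M + t^-1 *: E b c)); split.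
- by rewrite -scaleNr; apply: elem_unit => //; lia.
- by apply: tri_unitM; [apply: tri_unitM; exact: scale_unit|apply: elem_unit => //; lia].
rewrite -mulmxA !(mulmxA (E a b + _)) (@scale_last _ _ b _ bn); last first.
  by expand; rewrite NE // unit_entryM // (gtn_eqF bd) scale0r addr0.
rewrite (addrCA (t *: E a b)) (@scale_last _ _ d _ dn); last first.
  by expand; rewrite NE // unit_entryM // (ltn_eqF bd) scale0r scaler0 addr0.
have -> : (- t *: E c d + (t *: E a b + N)) *m (1%:M + t^-1 *: E b c) =
    (- t) *: E c d + (t *: E a b + N) + E a c.
  by expand; rewrite NE // !unit_entryM // eqxx (gtn_eqF bd); finish; field.
rewrite -scaleNr; expand; rewrite EN // !unit_entryM // eqxx (gtn_eqF ac).
by finish; field.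
Qed.
End Lines.

Section MoveLines.
Variables (K : fieldType) (n : nat).
Implicit Types (l : seq (nat * nat)).

Lemma arc_diagram_behead a l : arc_diagram n (a :: l) ->
  [/\ arc_diagram n l, (a.1 < a.2)%N, (a.2 < n)%N,
      a.1 \notin map fst l ++ map snd l & a.2 \notin map fst l ++ map snd l].
Proof.
move=> ld; have /andP[/= /andP[/andP[a12 a2n] al] _] := ld.
have := arc_diagram_uniq ld; rewrite /= => /andP[a1 u].
have : uniq (a.2 :: map fst l ++ map snd l).
  by move: u; rewrite -cat1s uniq_catCA.
rewrite /= => /andP[a2 u']; split=> //; first exact: arc_diagramI.
by apply: contra a1; rewrite !mem_cat inE => /orP[->//|->]; rewrite !orbT.
Qed.

Lemma arc_mx_absorb l (S : seq nat) : arc_diagram n l ->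
  (forall p, p \in S -> p \notin map fst l ++ map snd l) ->
  [/\ strictly_upper (arc_mx K n l), arc_mx K n l *m arc_mx K n l = 0,
    forall p q, p \in S -> arc_mx K n l *m unit_entry K n p q = 0
  & forall p q, q \in S -> (p < n)%N -> (q < n)%N -> unit_entry K n p q *m arc_mx K n l = 0].
Proof.
move=> ld Sl; split; [exact: arc_mx_strict|exact: arc_mx_sq| |].
- move=> p q /Sl; rewrite mem_cat negb_or => /andP[_ pl]; apply: arc_mxMr => //.
  by apply/allP => -[x y] /(arc_lt ld)/andP[].
- by move=> p q /Sl; rewrite mem_cat negb_or => /andP[ql _] pn qn; apply: arc_mxMl.
Qed.

Lemma move_line l l' : arc_diagram n l -> arc_diagram n l' -> arc_move l l' ->
  exists M, raising_line (arc_mx K n l') (arc_mx K n l) M.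
Proof.
move=> ld + mv; case: mv => [a b ab na nb|a m b l0 p amb nm|m f b l0 p amb nm
  |a b c d l0 p abc cd|a b c d l0 p abc cd] ld'; rewrite ?(arc_mx_perm _ _ p) !arc_mx_cons.
all: try rewrite (arc_pts_perm p) in nm.
all: try have {}ld := arc_diagram_perm p ld.
- have [] := @arc_mx_absorb l [:: a; b] ld.
    by move=> q; rewrite !inE => /orP[]/eqP->.
  move=> sN NN NE EN; exists (unit_entry K n a b); apply: (line_add sN NN NE EN) => //.
  by have /andP[/andP[/andP[_ ->]]] := ld'.
- have [ld0 /= ab bn a0 b0] := arc_diagram_behead ld.
  have m0 : m \notin map fst l0 ++ map snd l0.
    by apply: contra nm; rewrite !mem_cat !inE => /orP[]->; rewrite !orbT.
  have [] := @arc_mx_absorb l0 [:: a; m; b] ld0.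
    by move=> q; rewrite !inE => /or3P[]/eqP->.
  case/andP: amb => am mb.
  by move=> sN NN NE EN; exists (unit_entry K n a m); apply: (line_close sN NN NE EN).
- have [ld0 /= ab bn a0 b0] := arc_diagram_behead ld.
  have m0 : f \notin map fst l0 ++ map snd l0.
    by apply: contra nm; rewrite !mem_cat !inE => /orP[]->; rewrite !orbT.
  have [] := @arc_mx_absorb l0 [:: m; f; b] ld0.
    by move=> q; rewrite !inE => /or3P[]/eqP->.
  case/andP: amb => am mb.
  by move=> sN NN NE EN; exists (unit_entry K n f b); apply: (line_open sN NN NE EN).
all: have [ld1 /= ac cn a1 c1] := arc_diagram_behead ld.
all: have [ld0 /= bd dn b0 d0] := arc_diagram_behead ld1.
all: have sub q : q \notin map fst ((b, d) :: l0) ++ map snd ((b, d) :: l0) ->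
    q \notin map fst l0 ++ map snd l0.
1,3: by apply: contra; rewrite !mem_cat !inE => /orP[]->; rewrite !orbT.
all: have [] := @arc_mx_absorb l0 [:: a; b; c; d] ld0.
1,3: by move=> q; rewrite !inE => /or4P[]/eqP-> //; apply: sub.
all: case/andP: abc => ab bc sN NN NE EN.
- by exists (unit_entry K n b c); apply: (line_nest sN NN NE EN).
- by exists (unit_entry K n a b - unit_entry K n c d); apply: (line_uncross sN NN NE EN).
Qed.
End MoveLines.

(** * Square-zero matrices up to triangular conjugacy *)

Section NormalForm.
Variables (K : fieldType) (n : nat).
Implicit Types (u v b c : 'M[K]_n) (l : seq (nat * nat)).
Local Notation arc_mx := (arc_mx K n).

Definition tri_conj u v := exists b c,
  [/\ tri_unit b, tri_unit c, b *m c = 1%:M, c *m b = 1%:M & u = b *m v *m c].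

Lemma tri_conj_refl u : tri_conj u u.
Proof.
by exists 1%:M, 1%:M; split; rewrite ?mulmx1 ?mul1mx //; apply: tri_unit1.
Qed.

Lemma tri_conj_trans v u w : tri_conj u v -> tri_conj v w -> tri_conj u w.
Proof.
move=> [b [c [ub uc bc cb ->]]] [b' [c' [ub' uc' bc' cb' ->]]].
exists (b *m b'), (c' *m c); split; rewrite ?mulmxA //; try exact: tri_unitM.
- by rewrite -(mulmxA b) bc' mulmx1.
- by rewrite -(mulmxA c') cb mulmx1.
Qed.

Lemma tri_conj_strict u v : tri_conj u v -> strictly_upper u -> strictly_upper v.
Proof.
move=> [b [c [[ub _] [uc _] bc cb ->]]] su.
have -> : v = c *m (b *m v *m c) *m b by rewrite !mulmxA cb mul1mx -mulmxA cb mulmx1.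
by apply: strictly_upperMr => //; apply: strictly_upperMl.
Qed.

Lemma tri_conj_sq u v : tri_conj u v -> u *m u = 0 -> v *m v = 0.
Proof.
move=> [b [c [_ _ bc cb ->]]] uu.
have -> : v *m v = c *m (b *m v *m c *m (b *m v *m c)) *m b.
  by rewrite !mulmxA cb mul1mx -!mulmxA cb mulmx1 (mulmxA c) cb mul1mx.
by rewrite uu mulmx0 mul0mx.
Qed.

Lemma tri_conj_cols u b X k : tri_unit b ->
  (forall i j : 'I_n, (j < k)%N -> (b *m X) i j = (u *m b) i j) ->
  exists2 v, tri_conj u v & forall i j : 'I_n, (j < k)%N -> v i j = X i j.
Proof.
move=> ub bX; have [ubu [c uc [bc cb]]] := ub.
have tc : tri_unit c by split=> //; exists b.
exists (c *m u *m b).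
  exists b, c; split=> //.
  by rewrite !mulmxA bc mul1mx -mulmxA bc mulmx1.
move=> i j jk; have e : (u *m b) *m col_cut K n k = (b *m X) *m col_cut K n k.
  apply/matrixP => i' j'; rewrite !col_cutE.
  by have [j'k|_] := ltnP j' k; [rewrite bX|rewrite !mul0r].
have := congr1 (fun A => (c *m A) i j) e.
rewrite !mulmxA cb mul1mx !col_cutE jk !mul1r; exact.
Qed.

Lemma col_opMl m (q : 'I_n) (w : 'cV[K]_n) (A : 'M[K]_(n, m)) i j :
  (col_op q w *m A) i j = A i j + w i 0 * (A q j).
Proof.
rewrite /col_op mulmxDl mul1mx mxE -mulmxA [X in _ + X]mxE big_ord1; congr (_ + _ * _).
rewrite mxE (bigD1 q) //= mxE eqxx mul1r big1 ?addr0 // => k kq.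
by rewrite mxE (negPf (kq : (k != q :> nat))) mul0r.
Qed.

Lemma col_opMr (q : 'I_n) (w : 'cV[K]_n) (A : 'M[K]_n) i j :
  (A *m col_op q w) i j = A i j + (A *m w) i 0 * (j == q)%:R.
Proof.
rewrite /col_op mulmxDr mulmx1 mxE mulmxA [X in _ + X]mxE big_ord1.
by rewrite [X in _ * X]mxE.
Qed.

Lemma arc_mxE_row l (i j : 'I_n) : (i : nat) \notin map fst l -> arc_mx l i j = 0.
Proof.
move=> il; rewrite summxE big_seq big1 // => a al; rewrite mxE.
by case: eqP => // ia; case/negP: il; apply/mapP; exists a.
Qed.

Lemma arc_mxE_col l (i j : 'I_n) : (j : nat) \notin map snd l -> arc_mx l i j = 0.
Proof.
move=> jl; rewrite summxE big_seq big1 // => a al; rewrite mxE.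
case: (j =P a.2 :> nat) => [ja|_]; last by rewrite andbF.
by case/negP: jl; rewrite ja; apply: map_f.
Qed.

Lemma arc_mxE l (p q : 'I_n) (i : 'I_n) : arc_diagram n l -> (p : nat, q : nat) \in l ->
  arc_mx l i q = (i == p)%:R.
Proof.
move=> ld pq; have /arc_mx_perm-> := arc_rem pq; rewrite arc_mx_cons mxE.
have := arc_diagram_perm (arc_rem pq) ld => /arc_diagram_behead[ld' _ _ _].
rewrite mem_cat negb_or => /andP[_ /= q']; rewrite arc_mxE_col // addr0 mxE.
by rewrite eqxx andbT.
Qed.

Lemma arc_mxMcol l (p q : 'I_n) (z : 'cV[K]_n) : arc_diagram n l -> (p : nat, q : nat) \in l ->
  (arc_mx l *m z) p 0 = z q 0.
Proof.
move=> ld pq; have /arc_mx_perm-> := arc_rem pq; rewrite arc_mx_cons mulmxDl mxE.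
have := arc_diagram_perm (arc_rem pq) ld => /arc_diagram_behead[ld' _ _ + _].
rewrite mem_cat negb_or => /andP[/= p' _]; rewrite [X in _ + X]mxE.
rewrite [X in _ + X]big1 ?addr0 => [|k _]; last by rewrite arc_mxE_row ?mul0r.
rewrite mxE (bigD1 q) //= mxE !eqxx mul1r big1 ?addr0 // => k kq.
by rewrite mxE (negPf (kq : (k != q :> nat))) andbF mul0r.
Qed.

Lemma arc_mxMcol0 l (i : 'I_n) (z : 'cV[K]_n) : (i : nat) \notin map fst l ->
  (arc_mx l *m z) i 0 = 0.
Proof. by move=> il; rewrite mxE big1 // => k _; rewrite arc_mxE_row ?mul0r. Qed.

Lemma mulmx_cols k u v (z : 'cV[K]_n) :
  (forall i j : 'I_n, (j < k)%N -> u i j = v i j) ->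
  (forall i : 'I_n, (k <= i)%N -> z i 0 = 0) -> u *m z = v *m z.
Proof.
move=> uv z0; apply/matrixP => i j; rewrite !mxE; apply: eq_bigr => q _; rewrite ord1.
by have [qk|kq] := ltnP q k; [rewrite uv|rewrite z0 ?mulr0].
Qed.

Lemma mulmx_col u v (j : 'I_n) : u *m v = 0 -> u *m col j v = 0.
Proof. by move=> uv; rewrite colE mulmxA uv mul0mx. Qed.

(** Column [m] is cleared at left ends by subtracting columns of the arc matrix, and vanishes at
    right ends because [u *m u = 0]. The remainder [x] lives on free points; if it is nonzero, its
    last index [f] becomes the left end of a new arc ending at [m]. *)
Lemma reduce_column u l (m : 'I_n) : strictly_upper u -> u *m u = 0 ->
  arc_diagram n l -> all (fun a => a.2 < m)%N l ->
  (forall i j : 'I_n, (j < m)%N -> u i j = arc_mx l i j) ->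
  exists l' v, [/\ tri_conj u v, arc_diagram n l', all (fun a => a.2 < m.+1)%N l' &
    forall i j : 'I_n, (j < m.+1)%N -> v i j = arc_mx l' i j].
Proof.
move=> su uu ld lm ul.
have ln p q : (p, q) \in l -> (p < q)%N /\ (q < m)%N.
  by move=> pq; have /andP[-> _] := arc_lt ld pq; have := allP lm _ pq.
have ml : (m : nat) \notin map fst l ++ map snd l.
  rewrite mem_cat negb_or; apply/andP; split; apply/negP => /mapP[[p q] /ln[] /= a b e]; lia.
have [mO mC] : (m : nat) \notin map fst l /\ (m : nat) \notin map snd l.
  by move: ml; rewrite mem_cat negb_or => /andP.
pose N := arc_mx l; pose v := col m u.
have v0 (i : 'I_n) : (m <= i)%N -> v i 0 = 0 by move=> mi; rewrite mxE su.
have Nv : N *m v = 0 by rewrite -(mulmx_cols ul v0); apply: mulmx_col.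
pose w := N^T *m v; pose x := v - N *m w.
have xE i : x i 0 = v i 0 - (N *m w) i 0 by rewrite !mxE.
have w0 (i : 'I_n) : (m <= i)%N -> w i 0 = 0.
  move=> mi; rewrite mxE big1 // => k _; rewrite mxE arc_mxE_col ?mul0r //.
  by apply/negP => /mapP[[p q] /ln[] /= a b e]; lia.
have x0 (i : 'I_n) : x i 0 != 0 -> (i < m)%N /\ (i : nat) \notin map fst l ++ map snd l.
  have [/mapP[[p q] pq /= ip]|iO] := boolP ((i : nat) \in map fst l).
    have qn : (q < n)%N by have /andP[] := arc_lt ld pq.
    have := pq; rewrite -ip => iq; rewrite xE.
    rewrite (arc_mxMcol (q := Ordinal qn) w ld) //=.
    rewrite [w _ _]mxE (bigD1 i) //= [N^T _ _]mxE (arc_mxE (p := i)) // eqxx mul1r.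
    rewrite big1 ?addr0 ?subrr ?eqxx // => k /negPf ki.
    by rewrite [N^T _ _]mxE (arc_mxE (p := i)) // ki mul0r.
  rewrite xE arc_mxMcol0 // subr0 => vi.
  split; first by rewrite ltnNge; apply: contra_neqN vi => /v0.
  rewrite mem_cat negb_or iO /=; apply/negP => /mapP[[p q] pq /= iq].
  have pn : (p < n)%N by have /andP[a b] := arc_lt ld pq; apply: ltn_trans b.
  move: pq vi; rewrite -iq => pq; rewrite -(arc_mxMcol (p := Ordinal pn) v ld) //.
  by rewrite -/N Nv mxE eqxx.
have xm0 (i : 'I_n) : (m <= i)%N -> x i 0 = 0.
  by move=> mi; apply/eqP; apply/negPn/negP => /x0[]; rewrite ltnNge mi.
have [u1 cu1 u1E] : exists2 u1, tri_conj u u1 & forall i j : 'I_n, (j < m.+1)%N ->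
    u1 i j = if j == m then x i 0 else N i j.
  pose X : 'M[K]_n := \matrix_(i, j) if j == m then x i 0 else N i j.
  have XE i j : X i j = if j == m then x i 0 else N i j by rewrite mxE.
  have [||u1 cu1 h] := @tri_conj_cols u (col_op m (- w)) X m.+1.
  - apply: col_op_unit => [i mi|]; first by rewrite mxE w0 ?oppr0 // ltnW.
    by rewrite mxE w0 // subr0 oner_neq0.
  - move=> i j jm; rewrite col_opMl col_opMr !XE.
    have [->|jm'] := eqVneq j m.
      rewrite (xm0 m (leqnn m)) mulr0 addr0 mulr1 mulmxN (mulmx_cols ul w0) xE -/N.
      by rewrite [v _ _]mxE [X in _ = _ + X]mxE.
    have {jm'}jm : (j < m)%N by rewrite ltn_neqAle jm'.
    rewrite (ul i j) // [N m j]arc_mxE_row // mulr0.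
    by rewrite mulr0.
  - by exists u1 => // i j jm; rewrite h // XE.
have su1 := tri_conj_strict cu1 su; have uu1 := tri_conj_sq cu1 uu.
have [x00|/cV0Pn[f0 xf0]] := eqVneq x 0.
  exists l, u1; split=> //; first by apply: sub_all lm => a /ltnW.
  move=> i j jm; rewrite u1E //; case: eqP => // ->.
  by rewrite x00 mxE arc_mxE_col.
(* Taking the last index makes the change of basis, which replaces the basis vector of [f] by [x],
   upper triangular. *)
have [f xf fmax] := @arg_maxnP _ f0 (fun i => x i 0 != 0) val xf0.
have [fm fl] := x0 _ xf.
have xgt (i : 'I_n) : (f < i)%N -> x i 0 = 0.
  by move=> fi; apply/eqP; apply/negPn/negP => xi; have : (i <= f)%N := fmax _ xi; rewrite leqNgt fi.
have [fO fC] : (f : nat) \notin map fst l /\ (f : nat) \notin map snd l.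
  by move: fl; rewrite mem_cat negb_or => /andP.
pose l' := (f : nat, m : nat) :: l.
have ld' : arc_diagram n l'.
  apply: (arc_move_diagram ld); first by rewrite /= ltn_ord; apply/allP => -[p q] /(arc_lt ld)/andP[].
  exact: Move_add.
have l'E i j : arc_mx l' i j = (i == f)%:R * (j == m)%:R + N i j.
  by rewrite arc_mx_cons mxE mxE /= -natrM mulnb.
pose d := x - delta_mx f 0.
have dE i : d i 0 = x i 0 - (i == f)%:R by rewrite !mxE eqxx andbT.
have [||u2 cu2 h] := @tri_conj_cols u1 (col_op f d) (arc_mx l') m.+1.
- apply: col_op_unit => [i fi|]; first by rewrite dE xgt // -val_eqE gtn_eqF // subr0.
  by rewrite dE eqxx addrCA subrr addr0.
- move=> i j jm; rewrite col_opMl col_opMr !l'E eqxx mul1r u1E //.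
  rewrite [N f j]arc_mxE_row // addr0 mulmxBr dE.
  (* As a column of [u1], the vector [x] is killed by [u1], just as the basis vector of [f] is; so
     the replacement disturbs no earlier column. *)
  have e0 : u1 *m x = 0.
    have <- : col m u1 = x by apply/matrixP => a b; rewrite mxE u1E // eqxx ord1.
    exact: mulmx_col.
  have e1 : (u1 *m delta_mx f 0) = col f u1 by rewrite colE.
  have -> : (u1 *m x - u1 *m delta_mx f 0) i 0 = - u1 i f by rewrite e0 e1 sub0r !mxE.
  rewrite u1E; last by rewrite ltnS ltnW.
  rewrite (negPf (_ : f != m)); last by apply: contraTneq fm => ->; rewrite ltnn.
  rewrite [N i f]arc_mxE_col // oppr0 mul0r addr0.
  have [->|jm'] := eqVneq j m; last by rewrite !mulr0 addr0 add0r.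
  by rewrite [N i m]arc_mxE_col // mulr1 addr0 mulr1 ?addr0 ?add0r ?mulr1 addrCA subrr addr0.
exists l', u2; split=> //; first exact: tri_conj_trans cu2.
by rewrite /= ltnSn; apply: sub_all lm => a /ltnW.
Qed.

Lemma normal_form u : strictly_upper u -> u *m u = 0 ->
  exists2 l, arc_diagram n l & tri_conj u (arc_mx l).
Proof.
move=> su uu.
have H m : (m <= n)%N -> exists l v, [/\ tri_conj u v, arc_diagram n l,
    all (fun a => a.2 < m)%N l & forall i j : 'I_n, (j < m)%N -> v i j = arc_mx l i j].
  elim: m => [_|m IH mn]; first by exists [::], u; split=> //; exact: tri_conj_refl.
  have [l [v [cv ld lm vl]]] := IH (ltnW mn).
  have [l' [v' [cv' ld' lm' vl']]] :=
    @reduce_column v l (Ordinal mn) (tri_conj_strict cv su) (tri_conj_sq cv uu) ld lm vl.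
  by exists l', v'; split=> //; exact: tri_conj_trans cv'.
have [l [v [cv ld _ vl]]] := H n (leqnn n); exists l => //.
suff <- : v = arc_mx l by [].
by apply/matrixP => i j; apply: vl.
Qed.
End NormalForm.

(** * Shapes and ranks *)

Section TwoColumnShapes.
Variable K : fieldType.

Lemma nilp_jordan_block_sq m : (m <= 2)%N ->
  nilp_jordan_block K m *m nilp_jordan_block K m = 0.
Proof.
move=> m2; apply/matrixP => i j; rewrite !mxE big1 // => k _; rewrite !mxE -natrM mulnb.
by rewrite (_ : _ && _ = false) //; have := ltn_ord j; lia.
Qed.

Lemma rank_nilp_jordan_block m : (m <= 2)%N -> \rank (nilp_jordan_block K m) = m.-1.
Proof.
case: m => [|[|[|//]]] _; first by rewrite flatmx0 mxrank0.
  rewrite (_ : nilp_jordan_block K 1 = 0) ?mxrank0 //.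
  by apply/matrixP => i j; rewrite !mxE !ord1.
rewrite (_ : nilp_jordan_block K 2 = delta_mx 0 1) ?mxrank_delta //.
by apply/matrixP => -[[|[|//]] ?] [[|[|//]] ?]; rewrite !mxE.
Qed.

Lemma has_shape_sq_rank m (u : 'M[K]_m) p q : has_shape u [:: p; q] ->
  [/\ u *m u = 0, \rank u = q & (p + q = m)%N].
Proof.
move=> [k [s [[s0 [P [Q [PQ QP ->]]]] lam]]].
(* The third part of the shape is the default 0 of [nth], which excludes blocks of size above 2. *)
have s2 i : (s i <= 2)%N.
  rewrite leqNgt; apply/negP => si; have := lam 2%N; rewrite /= => /esym/eqP.
  by rewrite cards_eq0 => /eqP/setP/(_ i); rewrite !inE si.
split.
- rewrite -!mulmxA (mulmxA P Q) PQ mul1mx (_ : _ *m (_ *m P) = 0) ?mulmx0 //.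
  rewrite -(submxcolK P) !mul_mxdiag_mxcol.
  under eq_mxcol => i do rewrite mulmxA nilp_jordan_block_sq // mul0mx.
  by rewrite mxcol0.
- have -> : \rank (Q *m nilp_jordan_mx K s *m P) = \rank (nilp_jordan_mx K s).
    apply/eqP; rewrite eqn_leq (leq_trans (mxrankM_maxl _ _) (mxrankM_maxr _ _)) /=.
    have {1}-> : nilp_jordan_mx K s = P *m (Q *m nilp_jordan_mx K s *m P) *m Q.
      by rewrite !mulmxA PQ mul1mx -mulmxA PQ mulmx1.
    by rewrite (leq_trans (mxrankM_maxl _ _) (mxrankM_maxr _ _)).
  rewrite rank_mxdiag; have /= -> := lam 1%N; rewrite -sum1dep_card [RHS]big_mkcond.
  apply: eq_bigr => i _; rewrite rank_nilp_jordan_block //.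
  by have := s0 i; have := s2 i; case: (s i) => [|[|[|]]].
- have : (\sum_i s i = m)%N.
    apply/eqP; rewrite eqn_leq; apply/andP; split.
      by have := mxrank1 K (\sum_i s i); rewrite -PQ => <-; rewrite (leq_trans (mxrankM_maxl _ _)) // rank_leq_col.
    by have := mxrank1 K m; rewrite -QP => {1}<-; rewrite (leq_trans (mxrankM_maxl _ _)) // rank_leq_col.
  move=> <-; have /= -> := lam 0%N; have /= -> := lam 1%N.
  rewrite -!sum1dep_card [X in (X + _)%N]big_mkcond [X in (_ + X)%N]big_mkcond -big_split /=.
  apply: eq_bigr => i _.
  by have := s0 i; have := s2 i; case: (s i) => [|[|[|]]].
Qed.

(** A Jordan basis of row vectors: each row of [A], a basis of the image, has a preimage in [X] and
    gives a block of size 2; a complement [C] of the image in the kernel gives the blocks of size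
    1. *)
Lemma sq_rank_has_shape m (u : 'M[K]_m) p q : u *m u = 0 -> \rank u = q -> (p + q = m)%N ->
  has_shape u [:: p; q].
Proof.
move=> uu ruq pqm.
pose A := row_base u; pose X := A *m pinvmx u; pose D := (kermx u :\: A)%MS.
pose C := row_base D; pose r := \rank D.
have Xu : X *m u = A by rewrite mulmxKpV // eq_row_base.
have Aker : (A <= kermx u)%MS.
  by apply/sub_kermxP; rewrite -Xu -mulmxA uu mulmx0.
have Cker : C *m u = 0.
  by apply/sub_kermxP; rewrite eq_row_base diffmxSl.
have rC : (\rank u + r = m - \rank u)%N.
  rewrite -mxrank_ker -(mxrank_cap_compl (kermx u) A) /r; congr (_ + _)%N.
  by rewrite (capmx_idPr Aker) eq_row_base.
pose s (i : 'I_(\rank u + r)) := if (i < \rank u)%N then 2 else 1%N.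
pose Y := col_mx X C.
pose B i : 'M[K]_(s i, m) := \matrix_(a, b) (if a == 0%N :> nat then Y i b else (Y *m u) i b).
pose P := \mxcol_i B i.
have Yu (i : 'I_(\rank u + r)) b : (\rank u <= i)%N -> (Y *m u) i b = 0.
  move=> ui; rewrite mul_col_mx Cker mxE; case: splitP => k ik; last by rewrite mxE.
  by have := ltn_ord k; rewrite -ik ltnNge ui.
have Pu : P *m u = nilp_jordan_mx K s *m P.
  rewrite mul_mxdiag_mxcol mxcol_mul; apply: eq_mxcol => i; apply/matrixP => a b.
  have -> : (B i *m u) a b = (if a == 0%N :> nat then (Y *m u) i b else (Y *m u *m u) i b).
    rewrite mxE; case: ifP => a0; rewrite [RHS]mxE; apply: eq_bigr => k _; by rewrite mxE a0.
  rewrite -mulmxA uu mulmx0 [(0 : 'M__) _ _]mxE.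
  rewrite [RHS]mxE; case: eqP => a0; last first.
    rewrite big1 // => k _; rewrite !mxE (_ : _ == _ = false) ?mul0r //.
    have := ltn_ord k; rewrite [X in (_ < X)%N]/s; case: ifP => _; lia.
  have [iu|ui] := ltnP i (\rank u); last first.
    rewrite Yu // big1 // => k _; rewrite !mxE (_ : _ == _ = false) ?mul0r //.
    have si : s i = 1%N by rewrite /s ltnNge ui.
    have := ltn_ord k; rewrite [X in (_ < X)%N]si; lia.
  have si : (1 < s i)%N by rewrite /s iu.
  have JE k : nilp_jordan_block K (s i) a k = (k == 1 :> nat)%N%:R.
    by rewrite mxE a0 eq_sym.
  have BE : B i (Ordinal si) b = (Y *m u) i b by rewrite mxE.
  rewrite (bigD1 (Ordinal si)) //= JE BE mul1r big1 ?addr0 // => k k1.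
  by rewrite JE (negPf (k1 : (k != 1 :> nat)%N)) mul0r.
have s0 i : (0 < s i)%N by rewrite /s; case: ifP.
have BP i : (B i <= P)%MS by rewrite -[B i](mxcolK B i) rowsub_sub.
have YP : (Y <= P)%MS.
  apply/row_subP => i; apply: submx_trans (BP i).
  by apply: (eq_row_sub (Ordinal (s0 i))); apply/rowP => b; rewrite !mxE.
have AP : (A <= P)%MS.
  apply/row_subP => i; pose i' := lshift r i.
  have si : (1 < s i')%N by rewrite /s /= ltn_ord.
  apply: submx_trans (BP i'); apply: (eq_row_sub (Ordinal si)); apply/rowP => b.
  have BE : B i' (Ordinal si) b = A i b by rewrite mxE /= mul_col_mx Xu col_mxEu.
  by rewrite [LHS]mxE BE [RHS]mxE.
have [XP CP] : (X <= P)%MS /\ (C <= P)%MS.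
  by move: YP; rewrite col_mx_sub => /andP.
have kerP : (kermx u <= P)%MS.
  rewrite -(addsmx_diff_cap_eq (kermx u) A) addsmx_sub; apply/andP; split.
    by rewrite -/D -(eq_row_base D).
  exact: submx_trans (capmxSr _ _) AP.
(* [G *m X] and the identity have the same product with [u], so they differ by rows of the kernel,
   which is already spanned. *)
have Psup : (1%:M <= P)%MS.
  pose G := u *m pinvmx A.
  have GA : G *m A = u by rewrite mulmxKpV // eq_row_base.
  rewrite -[1%:M](subrK (G *m X)) addmx_sub //; last by rewrite mulmx_sub.
  apply: submx_trans kerP; apply/sub_kermxP.
  by rewrite mulmxBl mul1mx -mulmxA Xu GA subrr.
have sumS : (\sum_i s i = m)%N.
  rewrite big_split_ord /= (eq_bigr (fun=> 2)) => [|i _]; last by rewrite /s /= ltn_ord.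
  rewrite [X in (_ + X)%N](eq_bigr (fun=> 1%N)) => [|i _]; last by rewrite /s /= ltnNge leq_addr.
  by rewrite !sum_nat_const !card_ord; lia.
have Pfull : row_full P by rewrite -sub1mx.
have Pfree : row_free P.
  by move: Pfull; rewrite /row_full /row_free => /eqP->; rewrite sumS.
exists (\rank u + r)%N, s; split.
  split; first by move=> i; rewrite /s; case: ifP.
  exists P, (pinvmx P); split; [exact: mulmxVp|exact: mulVpmx|].
  by rewrite -mulmxA -Pu mulmxA mulVpmx ?mul1mx.
case=> [|[|c]] /=.
- rewrite (eq_card (B := xpredT)) => [|i]; last by rewrite inE s0.
  by rewrite card_ord; lia.
- rewrite -sum1dep_card big_mkcond big_split_ord /=.
  rewrite (eq_bigr (fun=> 1%N)) => [|i _]; last by rewrite /s /= ltn_ord.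
  rewrite [X in (_ + X)%N]big1 => [|i _]; last by rewrite /s /= [(_ + _ < _)%N]ltnNge leq_addr.
  by rewrite sum_nat_const card_ord muln1 addn0.
- rewrite nth_nil; apply/esym/eqP; rewrite cards_eq0; apply/eqP/setP => i; rewrite !inE /s.
  by case: ifP.
Qed.
End TwoColumnShapes.

Section PrefixRanks.
Variables (K : fieldType) (n : nat) (closing : pred nat) (u : 'M[K]_n).
Hypotheses (su : strictly_upper u) (uu : u *m u = 0).
Hypothesis ru : forall m, (m <= n)%N -> \rank (win 0 m u) = closers closing 0 m.
Local Notation rowc := (row_cut K n).
Local Notation colc := (col_cut K n).

Lemma tr_row_cut x : (rowc x)^T = rowc x.
Proof. by apply/matrixP => i j; rewrite !mxE eq_sym; case: eqP => // ->. Qed.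

Lemma tr_col_cut y : (colc y)^T = colc y.
Proof. by apply/matrixP => i j; rewrite !mxE eq_sym; case: eqP => // ->. Qed.

Lemma rank_col_cut m : (m <= n)%N -> \rank (colc m) = m.
Proof.
move=> mn; rewrite -[RHS](rank_pid_mx K mn mn); congr (\rank _).
by apply/matrixP => i j; rewrite !mxE.
Qed.

Lemma col_cutM x y : (x <= y)%N -> colc x *m colc y = colc x.
Proof.
move=> xy; apply/matrixP => i j; rewrite col_cutE !mxE; case: (i =P j) => [->|_] /=; last by rewrite mulr0.
by rewrite -natrM mulnb; have [jx|] := ltnP j x; rewrite ?andbF // (leq_trans jx xy).
Qed.

Lemma col_cut_row_cut x : colc x *m rowc x = 0.
Proof.
apply/matrixP => i j; rewrite -[rowc x]tr_row_cut -[colc x]tr_col_cut -trmx_mul mxE row_cutE !mxE.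
by case: (j =P i) => [->|_] /=; rewrite ?mulr0 // -natrM mulnb leqNgt; case: (i < x)%N.
Qed.

Lemma row_cut0 : rowc 0 = 1%:M.
Proof. by apply/matrixP => i j; rewrite !mxE leq0n andbT. Qed.

(** Subspaces are row spaces, hence the transpose: [A y] spans the image under [u] of the first [y]
    basis vectors, and [Km m] is the kernel of [u] on the first [m]. *)
Let A y := colc y *m u^T.
Let Km m := (colc m :&: kermx u^T)%MS.

Lemma rank_win_tr x y : \rank (win x y u) = \rank (A y *m rowc x).
Proof. by rewrite -mxrank_tr /win !trmx_mul tr_row_cut tr_col_cut mulmxA. Qed.

Lemma rank_prefix y : (y <= n)%N -> \rank (A y) = closers closing 0 y.
Proof. by move=> yn; rewrite -ru // rank_win_tr row_cut0 mulmx1. Qed.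

Lemma rank_prefix_ker m : (m <= n)%N -> \rank (Km m) = openers closing 0 m.
Proof.
move=> mn; have := mxrank_mul_ker (colc m) u^T; rewrite -/(A m) rank_prefix // rank_col_cut //.
by have := openers_closers closing 0 m; rewrite /Km; lia.
Qed.

(** Discard the first [x] coordinates of [A y]. Passing from [A k] to [A y] adds at most the closers
    of [k, y) to the rank. As [u *m u = 0], [A k] lies in [Km k], of which [Km x] is discarded; at
    most the openers of [x, k) remain. *)
Lemma rank_win_prefix x k y : (x <= k)%N -> (k <= y)%N -> (y <= n)%N ->
  (\rank (win x y u) <= openers closing x k + closers closing k y)%N.
Proof.
move=> xk ky yn; have kn := leq_trans ky yn; have xn := leq_trans xk kn.
have AkAy : (A k <= A y)%MS by rewrite /A -(col_cutM ky) -mulmxA submxMl.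
have AK : (A k <= Km k)%MS.
  rewrite sub_capmx; apply/andP; split.
    rewrite -(tr_col_cut k) /A -[colc k *m u^T]trmxK trmx_mul trmxK tr_col_cut.
    by rewrite (col_cut_upper k (strictly_upperW su)) !trmx_mul tr_col_cut submxMl.
  by apply/sub_kermxP; rewrite /A -mulmxA -trmx_mul uu trmx0 mulmx0.
have KK : (Km x <= Km k :&: kermx (rowc x))%MS.
  rewrite sub_capmx; apply/andP; split.
    by apply: capmxS => //; rewrite -(col_cutM xk) submxMl.
  apply: submx_trans (capmxSl _ _) _; apply/sub_kermxP; exact: col_cut_row_cut.
have h1 := mxrank_mul_ker (A y) (rowc x); have h2 := mxrank_mul_ker (A k) (rowc x).
have h3 := mxrankS (capmxS AkAy (submx_refl (kermx (rowc x)))).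
have h4 := mxrankS (submxMr (rowc x) AK); have h5 := mxrank_mul_ker (Km k) (rowc x).
have h6 := mxrankS KK.
rewrite rank_win_tr; move: h1 h2 h3 h4 h5 h6; rewrite !rank_prefix // !rank_prefix_ker //.
have := @closersD closing 0 k y; have := @openersD closing 0 x k; lia.
Qed.
End PrefixRanks.

(** * Minors, and principal submatrices as windows *)

Section Submatrices.
Variable (K : fieldType).

(** [maxrankfun] gives independent rows without controlling their order, whereas a minor takes
    increasing indices; listing the selected set in increasing order keeps the row space. *)
Lemma exists_monotone_rowsub m p k (M : 'M[K]_(m, p)) : (k <= \rank M)%N ->
  exists2 f : 'I_k -> 'I_m, (forall a b : 'I_k, (a < b)%N -> (f a < f b)%N) &
    row_free (rowsub f M).
Proof.
move=> kr; pose f0 (i : 'I_k) := maxrankfun M (widen_ord kr i).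
have f0_inj : injective f0.
  by move=> i j /maxrankfun_inj/(congr1 val)/= ij; apply: val_inj.
have free0 : row_free (rowsub f0 M).
  have /row_freeP[B MB] := maxrowsub_free M; apply/row_freeP.
  pose W := rowsub (widen_ord kr) (1%:M : 'M[K]_(\rank M)).
  have e : rowsub f0 M = W *m rowsub (maxrankfun M) M.
    by rewrite /W -rowsubE; apply/matrixP => i j; rewrite !mxE.
  exists (B *m W^T); rewrite e mulmxA -(mulmxA W) MB mulmx1.
  apply/matrixP => i j; rewrite !mxE (bigD1 (widen_ord kr i)) //= !mxE eqxx mul1r big1 ?addr0.
    by rewrite -val_eqE /= eq_sym.
  by move=> l /negPf li; rewrite !mxE eq_sym li mul0r.
pose S := f0 @: setT.
have cS : #|S| = k by rewrite card_imset // cardsT card_ord.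
pose f (i : 'I_k) : 'I_m := enum_val (cast_ord (esym cS) i).
exists f.
  move=> a b ab; rewrite /f /enum_val.
  set x0 := enum_default _; set x1 := enum_default _.
  rewrite (set_nth_default x0 x1) /=; last by rewrite -cardE cS.
  have so : sorted (fun x y : 'I_m => (x < y)%N) (enum S).
    rewrite {1}/enum_mem; apply: sorted_filter; first by move=> ? ? ?; apply: ltn_trans.
    have := iota_ltn_sorted 0 m; rewrite -val_enum_ord sorted_map.
    by rewrite enumT.
  apply: (sorted_ltn_nth (leT := fun x y : 'I_m => (x < y)%N)) => //.
  - by move=> ? ? ?; apply: ltn_trans.
  - by rewrite inE -cardE cS.
  - by rewrite inE -cardE cS.
rewrite /row_free eqn_leq rank_leq_row /=.
have /eqP {1}<- : row_free (rowsub f0 M) := free0.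
apply: mxrankS; apply/row_subP => i; rewrite row_rowsub.
have fS : f0 i \in S by apply: imset_f.
apply: (eq_row_sub (cast_ord cS (enum_rank_in fS (f0 i)))).
by rewrite row_rowsub /f cast_ordK enum_rankK_in.
Qed.

Lemma minors_rank m p r (M : 'M[K]_(m, p)) :
  (forall d, is_minor r.+1 M d -> d = 0) <-> (\rank M <= r)%N.
Proof.
split=> [H|rM d [f [g [_ _ ->]]]].
  rewrite leqNgt; apply/negP => /exists_monotone_rowsub[f fm ff].
  have : (r < \rank (rowsub f M)^T)%N by rewrite mxrank_tr (eqP ff).
  move/exists_monotone_rowsub=> [g gm gf].
  have : \det (mxsub f g M) = 0 by apply: H; exists f, g.
  apply/eqP; rewrite -unitfE -/(_ \is a GRing.unit) -unitmxE -unitmx_tr -row_free_unit.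
  by rewrite (_ : _^T = rowsub g (rowsub f M)^T) //; apply/matrixP => i j; rewrite !mxE.
apply/eqP; apply: contraTT rM => dn; rewrite -ltnNge.
have /mxrank_unit <- : mxsub f g M \in unitmx by rewrite unitmxE unitfE.
rewrite -[M]mulmx1 mxsub_mul (leq_trans (mxrankM_maxl _ _)) // mxrankS //.
by rewrite mulmx1 rowsub_sub.
Qed.

Variable n : nat.
Implicit Types (u : 'M[K]_n) (i j : 'I_n).

Definition incl i j : 'M[K]_(n, j.+1 - i) := \matrix_(a, k) (a == rng k)%:R.

Lemma pi_subE i j u : pi_sub i j u = (incl i j)^T *m u *m incl i j.
Proof.
apply/matrixP => a b; rewrite !mxE (bigD1 (rng b)) //= big1 => [|k kb]; last first.
  by rewrite [incl _ _ _ _]mxE (negPf kb) mulr0.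
rewrite [incl _ _ _ _]mxE eqxx mulr1 addr0 mxE (bigD1 (rng a)) //= big1 => [|k ka]; last first.
  by rewrite !mxE (negPf ka) mul0r.
by rewrite !mxE eqxx mul1r addr0.
Qed.

Lemma rng_inj i j : injective (@rng n i j).
Proof. by move=> a b /(congr1 val)/= /addnI ab; apply: val_inj. Qed.

Lemma trmx_inclK i j : (incl i j)^T *m incl i j = 1%:M.
Proof.
apply/matrixP => a b; rewrite !mxE (bigD1 (rng a)) //= !mxE eqxx mul1r big1 ?addr0.
  by rewrite (inj_eq (@rng_inj i j)).
by move=> k /negPf ka; rewrite !mxE ka mul0r.
Qed.

Lemma incl_trmxK i j : incl i j *m (incl i j)^T = row_cut K n i *m col_cut K n j.+1.
Proof.
apply/matrixP => a b; rewrite row_cutE !mxE.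
have [ab|ab] := eqVneq a b; last first.
  rewrite /= mulr0 big1 // => k _; rewrite !mxE; case: (a =P _) => [ak|]; last by rewrite mul0r.
  by rewrite -ak eq_sym (negPf ab) mulr0.
subst b; rewrite /= -natrM mulnb.
have [|] := boolP ((i <= a) && (a < j.+1))%N; last first.
  move=> h; rewrite big1 // => k _; rewrite !mxE; case: (a =P _) => [ak|]; last by rewrite mul0r.
  case/negP: h; rewrite ak /= leq_addr /=; have := ltn_ord k; lia.
case/andP=> ia aj; have h : (a - i < j.+1 - i)%N by rewrite ltn_sub2r // (leq_ltn_trans ia aj).
have ra : rng (Ordinal h) = a by apply: val_inj; rewrite /= subnKC.
rewrite (bigD1 (Ordinal h)) //= !mxE ra eqxx mulr1 big1 ?addr0 // => k kh.
rewrite !mxE -ra (inj_eq (@rng_inj i j)) eq_sym (negPf kh) mul0r //.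
Qed.

Lemma incl_win i j u : strictly_upper u ->
  incl i j *m (incl i j)^T *m u *m (incl i j *m (incl i j)^T) = win i j.+1 u.
Proof.
move=> su; rewrite incl_trmxK -!mulmxA; apply/matrixP => a b; rewrite /win -mulmxA.
rewrite !row_cutE col_cutEl !mulmxA !col_cutE row_cutEr.
have [ba|ab] := leqP b a; first by rewrite su // !mulr0.
rewrite !mulrA -!natrM !mulnb; congr (_%:R * _).
by congr nat_of_bool; lia.
Qed.

Lemma rank_pi_sub i j u : strictly_upper u -> \rank (pi_sub i j u) = \rank (win i j.+1 u).
Proof.
move=> su; apply/eqP; rewrite eqn_leq; apply/andP; split.
  have -> : pi_sub i j u = (incl i j)^T *m win i j.+1 u *m incl i j.
    rewrite -incl_win // !mulmxA trmx_inclK mul1mx -!mulmxA trmx_inclK mulmx1.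
    by rewrite pi_subE !mulmxA.
  by rewrite (leq_trans (mxrankM_maxl _ _)) // mxrankM_maxr.
have -> : win i j.+1 u = incl i j *m pi_sub i j u *m (incl i j)^T.
  by rewrite -incl_win // pi_subE !mulmxA.
by rewrite (leq_trans (mxrankM_maxl _ _)) // mxrankM_maxr.
Qed.

Lemma incl_cut i j :
  row_cut K n i *m incl i j = incl i j /\ col_cut K n j.+1 *m incl i j = incl i j.
Proof.
split; apply/matrixP => a b; rewrite ?row_cutE ?col_cutEl mxE;
  case: (a =P _) => [->|_]; rewrite ?mulr0 // mulr1 /=.
  by rewrite leq_addr.
by rewrite (_ : (_ < _)%N = true) //; have := ltn_ord b; lia.
Qed.

(** In a product of upper triangular matrices the intermediate index lies between the outer ones,
    hence in the same interval. *)
Lemma pi_sub_sq i j u : upper u -> pi_sub i j u *m pi_sub i j u = pi_sub i j (u *m u).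
Proof.
move=> uu; have [rc cc] := incl_cut i j.
have cr : (incl i j)^T *m row_cut K n i = (incl i j)^T.
  by rewrite -{2}rc trmx_mul tr_row_cut.
have e1 : (incl i j)^T *m u *m row_cut K n i = (incl i j)^T *m u.
  by rewrite -cr -!mulmxA (mulmxA (row_cut _ _ _) u) -row_cut_upper.
have e2 : col_cut K n j.+1 *m (u *m incl i j) = u *m incl i j.
  by rewrite -cc (mulmxA u) (col_cut_upper _ uu) -!mulmxA (mulmxA (col_cut _ _ _) (col_cut _ _ _))
    col_cutM.
have -> : pi_sub i j u *m pi_sub i j u =
    (incl i j)^T *m u *m row_cut K n i *m (col_cut K n j.+1 *m (u *m incl i j)).
  rewrite !pi_subE !mulmxA -(mulmxA _ (incl i j) (incl i j)^T) incl_trmxK.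
  by rewrite !mulmxA.
by rewrite e1 e2 pi_subE !mulmxA.
Qed.
End Submatrices.

Lemma N_sigmaE (R : realType) n (T : tableau2 n) : N_sigma R T = arc_mx _ n (sigma_arcs T).
Proof.
apply/matrixP => i j; rewrite mxE /arc_mx summxE -sigma_arc_mem.
have /andP[_ u] := sigma_arc_diagram T.
have us : uniq (sigma_arcs T).
  by apply: (@map_uniq _ _ fst); move: u; rewrite cat_uniq => /and3P[].
rewrite -(count_uniq_mem _ us) -sum1_count big_mkcond natr_sum; apply: eq_bigr => -[p q] _.
by rewrite mxE /= xpair_eqE [p == _]eq_sym [q == _]eq_sym; case: ifP.
Qed.

(** * The rank variety *)

Section Geometry.
Variables (R : realType) (n : nat).
Local Notation K := (complex R).
Implicit Types (u v M : 'M[K]_n) (f g : polyfun R n).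

Definition coords u (v : 'I_#|{: pos n}|) : K :=
  let q := val (enum_val v : pos n) in u q.1 q.2.

Lemma mxevalE f u : mxeval f u = f.@[coords u].
Proof. by []. Qed.

Lemma map_generic_mx u : strictly_upper u ->
  map_mx (meval (coords u)) (generic_mx R n) = u.
Proof.
move=> su; apply/matrixP => i j; rewrite !mxE; case: insubP => [p _ pij|] /=.
  by rewrite mevalXU /coords enum_rankK pij.
by rewrite meval0 -leqNgt => /su.
Qed.

Lemma coords_surj (x : 'I_#|{: pos n}| -> K) : exists2 u, strictly_upper u & coords u =1 x.
Proof.
exists (\matrix_(i, j) if insub (i, j) is Some p then x (enum_rank (p : pos n)) else 0).
  by move=> i j ji; rewrite mxE insubN //= -leqNgt.
move=> v; rewrite /coords mxE -surjective_pairing valK.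
by rewrite enum_valK.
Qed.

Lemma mxeval_sq u (i j : 'I_n) : strictly_upper u ->
  mxeval ((generic_mx R n *m generic_mx R n) i j) u = (u *m u) i j.
Proof.
move=> su; rewrite -{2 3}(map_generic_mx su) -map_mxM.
by rewrite [RHS]mxE.
Qed.

Lemma mxeval_minor (i j : 'I_n) r f u : strictly_upper u ->
  is_minor r (pi_sub i j (generic_mx R n)) f -> is_minor r (pi_sub i j u) (mxeval f u).
Proof.
move=> su [a [b [am bm ->]]]; exists a, b; split=> //.
rewrite mxevalE -det_map_mx !map_mxsub; congr (\det (mxsub _ _ (mxsub _ _ _))).
exact: map_generic_mx.
Qed.

Lemma minor_mxeval (i j : 'I_n) r d u : strictly_upper u -> is_minor r (pi_sub i j u) d ->
  exists2 f, is_minor r (pi_sub i j (generic_mx R n)) f & mxeval f u = d.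
Proof.
move=> su [a [b [am bm ->]]]; exists (\det (mxsub a b (pi_sub i j (generic_mx R n)))).
  by exists a, b.
rewrite mxevalE -det_map_mx !map_mxsub; congr (\det (mxsub _ _ (mxsub _ _ _))).
exact: map_generic_mx.
Qed.

Lemma zeros_ideal_gen (G : polyset R n) u : zeros (ideal_gen G) u <-> zeros G u.
Proof.
split=> -[su H]; split=> // f.
  move=> Gf; apply: H; exists 1%N, (fun _ => 1), (fun _ => f); split=> //.
  by rewrite big_ord1 mul1r.
move=> [m [c [g [Gg ->]]]]; rewrite mxevalE rmorph_sum big1 // => k _.
by rewrite rmorphM /=; have -> : (g k).@[coords u] = 0 := H _ (Gg k); rewrite mulr0.
Qed.

Lemma zariski_closure_sub (Z W : mxset R n) : (forall u, Z u -> W u) ->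
  forall u, zariski_closure Z u -> zariski_closure W u.
Proof. by move=> ZW u Zu E WE; apply: Zu => v /ZW; apply: WE. Qed.

Lemma zariski_closure_incl (Z : mxset R n) u : Z u -> zariski_closure Z u.
Proof. by move=> Zu E; apply. Qed.

Lemma zariski_closure_idem (Z W : mxset R n) :
  (forall u, W u -> zariski_closure Z u) -> forall u, zariski_closure W u -> zariski_closure Z u.
Proof. by move=> WZ u Wu E ZE; apply: Wu => v /WZ; apply. Qed.

(** Along the line a polynomial function becomes a polynomial in [t] that vanishes for [t != 0]. Its
    product with ['X] has no non-root in an algebraically closed field, hence is 0. *)
Lemma zariski_closure_line (Z : mxset R n) u M : strictly_upper u ->
  (forall t, t != 0 -> zariski_closure Z (u + t *: M)) -> zariski_closure Z u.
Proof.
move=> su H E ZE; split=> // f Ef.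
pose h (v : 'I_#|{: pos n}|) : {poly K} := (coords u v)%:P + coords M v *: 'X.
have pE t : horner_eval t (mmap polyC h f) = mxeval f (u + t *: M).
  apply: (@mpoly_rmorph_ext _ _ _ (horner_eval t \o mmap polyC h) (meval (coords (u + t *: M)))).
    by move=> c /=; rewrite mmapC mevalC /horner_eval hornerC.
  move=> i /=; rewrite mmapX mmap1U mevalXU /horner_eval /h /coords !mxE.
  by rewrite hornerD hornerC hornerZ hornerX mulrC.
have : mmap polyC h f * 'X = 0.
  apply/eqP; apply/negPn/negP => /closed_nonrootP[t]; rewrite rootE hornerM hornerX mulf_eq0.
  rewrite negb_or => /andP[+ t0]; rewrite -[_.[t]]/(horner_eval t _) pE.
  by have [_ ->] := H t t0 E ZE; rewrite ?eqxx.
move/eqP; rewrite mulf_eq0 polyX_eq0 orbF => /eqP p0.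
by have := pE 0; rewrite p0 scale0r addr0 /horner_eval horner0.
Qed.

Variable T : tableau2 n.
Local Notation closing := (closing T).

Definition rank_variety u := [/\ strictly_upper u, u *m u = 0 &
  forall x k y, (x <= k)%N -> (k <= y)%N -> (y <= n)%N ->
    (\rank (win x y u) <= openers closing x k + closers closing k y)%N].

Lemma R_sigmaE (i j : 'I_n) : R_sigma R T i j = arc_count (sigma_arcs T) i j.+1.
Proof.
have ld := sigma_arc_diagram T.
by rewrite /R_sigma rank_pi_sub N_sigmaE ?rank_win_arc_mx //; apply: arc_mx_strict.
Qed.

(** The bounds for all cuts together amount to the single bound by [R_sigma]: [sigma_arcs_bounded]
    gives one direction, [sigma_arcs_tight] the other. *)
Lemma zeros_ideal_BP u : zeros (ideal_B R T) u <-> rank_variety u.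
Proof.
rewrite zeros_ideal_gen; split=> [[su H]|[su uu ru]].
  split=> //.
    apply/matrixP => i j; rewrite [RHS]mxE; have [ij|ji] := ltnP i j.
      by rewrite -mxeval_sq //; apply: H; left; exists i, j.
    by rewrite (strictly_upperMl (strictly_upperW su) su).
  (* The minors concern windows with at least two points; on shorter ones a strictly upper matrix
     vanishes. *)
  move=> x k y xk ky yn; have [xy|yx] := ltnP x.+1 y; last first.
    have -> : win x y u = 0.
      apply/matrixP => i j; rewrite winE [RHS]mxE; case: andP => [[xi jy]|_]; last exact: mul0r.
      by rewrite mul1r su //; lia.
    by rewrite mxrank0.
  have xn : (x < n)%N by lia.
  have yn' : (y.-1 < n)%N by lia.
  pose i := Ordinal xn; pose j := Ordinal yn'.
  have ey : y = j.+1 by rewrite /=; lia.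
  rewrite {1}ey -[x]/(val i) -rank_pi_sub //.
  have : (\rank (pi_sub i j u) <= R_sigma R T i j)%N.
    apply/minors_rank => d /(minor_mxeval su)[f fm <-]; apply: H; right; exists i, j.
    by split=> //=; lia.
  move/leq_trans; apply; rewrite R_sigmaE -ey; exact: sigma_arcs_bounded.
split=> // f [[i [j [ij ->]]]|[i [j [ij fm]]]].
  by rewrite mxeval_sq // uu mxE.
have [k [ik kj tight]] := @sigma_arcs_tight n T i j.+1 (ltnW (leqW ij)) (ltn_ord j).
apply: (minors_rank _ _).2 (mxeval_minor su fm).
rewrite rank_pi_sub // R_sigmaE; apply: leq_trans tight; exact: ru.
Qed.

Definition prefix_variety u := [/\ strictly_upper u, u *m u = 0 &
  forall m, (m <= n)%N -> \rank (win 0 m u) = closers closing 0 m].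

Lemma prefix_rank_variety u : prefix_variety u -> rank_variety u.
Proof. by case=> su uu ru; split=> // x k y; apply: rank_win_prefix. Qed.

Lemma nuP u : nu T u <-> prefix_variety u.
Proof.
split=> [[su H]|[su uu ru]]; last first.
  split=> // i; rewrite subshapeE //; apply: sq_rank_has_shape.
  - rewrite pi_sub_sq ?uu; last exact: strictly_upperW.
    by apply/matrixP => a b; rewrite !mxE.
  - by rewrite rank_pi_sub // ru.
  - by rewrite openers_closers.
have sq (i : 'I_n) := has_shape_sq_rank (eq_ind _ (has_shape _) (H i) _ (subshapeE T (ltn_ord i))).
split=> //.
  have [n0|n1] := posnP n; first by apply/matrixP => i; have := ltn_ord i; rewrite [X in (_ < X)%N]n0.
  have ln : (n.-1 < n)%N by rewrite prednK.
  pose i := Ordinal ln; have [sqi _ _] := sq i.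
  have suu : strictly_upper (u *m u) by apply: strictly_upperMl => //; apply: strictly_upperW.
  have wE : win 0 n (u *m u) = win (ord_first i) i.+1 (u *m u) by rewrite /= prednK.
  rewrite -[LHS]win_full wE -incl_win //.
  have -> : incl K (ord_first i) i *m (incl K (ord_first i) i)^T *m (u *m u) *m
      (incl K (ord_first i) i *m (incl K (ord_first i) i)^T) =
      incl K (ord_first i) i *m pi_sub (ord_first i) i (u *m u) *m (incl K (ord_first i) i)^T.
    by rewrite pi_subE !mulmxA.
  by rewrite -pi_sub_sq ?sqi ?mulmx0 ?mul0mx //; apply: strictly_upperW.
case=> [|m] mn.
  rewrite closers_geq //; apply/eqP; rewrite mxrank_eq0; apply/eqP/matrixP => i j.
  by rewrite winE ltn0 andbF mul0r mxE.
by have [_ + _] := sq (Ordinal mn); rewrite rank_pi_sub.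
Qed.

Lemma nu_orbital u : nu T u -> orbital_variety R T u.
Proof.
move=> nuu; split; first exact: zariski_closure_incl.
have [su uu ru] := (nuP u).1 nuu; rewrite shape2E; apply: sq_rank_has_shape => //.
  by rewrite -ru // win_full.
by rewrite openers_closers subn0.
Qed.

Definition total_rank u := (\sum_(x < n.+1) \sum_(y < n.+1) \rank (win x y u))%N.

Lemma total_rank_bound u : (total_rank u <= n.+1 * (n.+1 * n))%N.
Proof.
rewrite -[X in (X * _)%N](card_ord n.+1) -sum_nat_const; apply: leq_sum => x _.
rewrite -[X in (X * _)%N](card_ord n.+1) -sum_nat_const; apply: leq_sum => y _.
exact: rank_leq_row.
Qed.

(* Descending induction on the total rank of all windows. *)
Lemma rank_variety_closure u : rank_variety u -> zariski_closure (nu T) u.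
Proof.
have [k] := ubnP (n.+1 * (n.+1 * n) - total_rank u); elim: k u => // k IH u /ltnSE uk ruv.
have [su uu ru] := ruv.
have [/existsNP[m /not_implyP[mn neq]]|/contrapT all_eq] :=
    EM (~ forall m, (m <= n)%N -> \rank (win 0 m u) = closers closing 0 m); last first.
  by apply: zariski_closure_incl; apply/nuP.
have [l ld [b [c [ub uc bc cb ue]]]] := normal_form su uu.
have rl x y : \rank (win x y u) = arc_count l x y.
  by rewrite ue rank_win_tri // rank_win_arc_mx.
have lb : bounded_by closing n l by move=> x k' y *; rewrite -rl; apply: ru.
have [|l' [mv ld' lb' mono [x0 [y0 [x0n y0n lt]]]]] :=
    @exists_raise closing n l (@tableau_ballot n T) ld lb.
  by exists m => //; rewrite -rl.
have [M line] := move_line K ld ld' mv.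
(* The line of the diagram is carried to [u] by the conjugation that normalizes [u], which preserves
   square zero; the ranks on it come from the equivalence given by [line]. *)
apply: (@zariski_closure_line _ u (b *m M *m c) su) => t t0.
have [sv vv [b' [c' [ub' uc' ve]]]] := line t t0.
set v := arc_mx K n l + t *: M in sv vv ve.
have -> : u + t *: (b *m M *m c) = b *m v *m c.
  by rewrite ue /v mulmxDr mulmxDl -scalemxAr -scalemxAl.
have rv x y : \rank (win x y (b *m v *m c)) = arc_count l' x y.
  by rewrite rank_win_tri // ve rank_win_tri // rank_win_arc_mx.
apply: IH.
  have lt_total : (total_rank u < total_rank (b *m v *m c))%N.
    pose x1 := Ordinal (x0n : x0 < n.+1)%N; pose y1 := Ordinal (y0n : y0 < n.+1)%N.
    rewrite /total_rank (bigD1 x1) //= [X in (_ < X)%N](bigD1 x1) //= -addSn; apply: leq_add.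
      rewrite (bigD1 y1) //= [X in (_ < X)%N](bigD1 y1) //= -addSn; apply: leq_add.
        by rewrite rl rv.
      by apply: leq_sum => y _; rewrite rl rv.
    by apply: leq_sum => x _; apply: leq_sum => y _; rewrite rl rv.
  by have := total_rank_bound (b *m v *m c); lia.
split.
- apply: strictly_upperMr; first by case: uc.
  by apply: strictly_upperMl => //; case: ub.
- rewrite !mulmxA -(mulmxA _ c b) cb mulmx1 -(mulmxA b) vv mulmx0 mul0mx //.
- by move=> x k' y xk ky yn; rewrite rv; apply: lb'.
Qed.

(** [nu T] and the orbital variety have the same closure, since each lies in the closure of the
    other. *)
Lemma zeros_ideal_B_closure u :
  zeros (ideal_B R T) u <-> zariski_closure (orbital_variety R T) u.
Proof.
split=> [/zeros_ideal_BP/rank_variety_closure|].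
  by apply: zariski_closure_sub => v; apply: nu_orbital.
move/(zariski_closure_idem (fun v (h : orbital_variety R T v) => h.1)); apply=> v /nuP/prefix_rank_variety.
by move/zeros_ideal_BP.
Qed.

(** * Radicals and vanishing ideals *)

Lemma ideal_gen_ideal (G : polyset R n) : is_ideal (ideal_gen G).
Proof.
split.
- exists 0%N, (fun _ => 0), (fun _ => 0); split; first by case.
  by rewrite big_ord0.
- move=> _ _ [m [c [g [Gg ->]]]] [m' [c' [g' [Gg' ->]]]].
  exists (m + m')%N, (fun k => match split k with inl i => c i | inr i => c' i end),
    (fun k => match split k with inl i => g i | inr i => g' i end).
  split; first by move=> k; case: (split k).
  rewrite big_split_ord /=; congr (_ + _); apply: eq_bigr => i _.
    by rewrite -[lshift _ _]/(unsplit (inl i)) unsplitK.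
  by rewrite -[rshift _ _]/(unsplit (inr i)) unsplitK.
- move=> h _ [m [c [g [Gg ->]]]]; exists m, (fun k => h * c k), g; split=> //.
  by rewrite mulr_sumr; apply: eq_bigr => k _; rewrite mulrA.
Qed.

Lemma radical_sub (J : polyset R n) f : J f -> radical J f.
Proof. by exists 1%N; rewrite expr1. Qed.

Lemma ideal_exp_leq (J : polyset R n) f k m : is_ideal J -> (k <= m)%N -> J (f ^+ k) -> J (f ^+ m).
Proof. by move=> [_ _ JM] km Jf; rewrite -(subnK km) exprD; apply: JM. Qed.

Lemma radical_ideal (J : polyset R n) : is_ideal J -> is_ideal (radical J).
Proof.
move=> Ji; have [J0 JD JM] := Ji; split.
- exact: radical_sub.
- move=> f g [k [k0 Jf]] [m [m0 Jg]]; exists (k + m)%N; split; first by rewrite addn_gt0 k0.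
  rewrite exprDn; apply: (@ideal_sum _ J Ji) => i _; rewrite -mulr_natl; apply: (JM).
  have [im|mi] := leqP m i.
    by apply: JM; apply: ideal_exp_leq Jg.
  rewrite mulrC; apply: JM; apply: ideal_exp_leq Jf => //.
  by rewrite -addnBA ?leq_addr // ltnW.
- move=> h f [k [k0 Jf]]; exists k; split=> //; rewrite exprMn; exact: JM.
Qed.

Lemma radical_idem (J : polyset R n) f : radical (radical J) f -> radical J f.
Proof.
move=> [k [k0 [m [m0 Jf]]]]; exists (k * m)%N; rewrite muln_gt0 k0 m0; split=> //.
by rewrite exprM.
Qed.

Lemma zeros_radical (J : polyset R n) u : zeros (radical J) u <-> zeros J u.
Proof.
split=> -[su H]; split=> // f; first by move/radical_sub; apply: H.
move=> [k [k0 /H]]; rewrite mxevalE rmorphXn => /eqP; rewrite expf_eq0 => /andP[_ /eqP].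
by [].
Qed.

Lemma radical_vanishing (J : polyset R n) f : is_ideal J ->
  (forall u, zeros J u -> mxeval f u = 0) -> radical J f.
Proof.
move=> Ji H; have [k Jk] : exists k, J (f ^+ k).
  apply: nullstellensatz => // x xJ; have [u su ux] := coords_surj x.
  rewrite -(meval_eq _ ux); apply: H; split=> // g /xJ.
  by rewrite -(meval_eq _ ux).
(* The Nullstellensatz may return the exponent 0, while [radical] asks for a positive one. *)
by exists k.+1; split=> //; apply: ideal_exp_leq Jk.
Qed.
End Geometry.

Theorem corollary4p4 (R : realType) (n : nat) (T : tableau2 n)
    (I : polyset R n) :
  is_ideal_of_definition (orbital_variety R T) I <-> I = radical (ideal_B R T).
Proof.
have Bi := ideal_gen_ideal (B_generator (R := R) T).
split=> [[Ii Irad IZ]|->]; last first.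
  split; [exact: radical_ideal|exact: radical_idem|].
  by move=> u; rewrite zeros_radical; apply: zeros_ideal_B_closure.
(* A radical ideal consists of the functions vanishing on its zeros, so two radical ideals with the
   same zeros coincide. *)
apply: funext => f; apply: propext; split=> [If|].
  apply: radical_vanishing => // u /zeros_ideal_B_closure/IZ[_]; exact.
move=> Jf; apply: Irad; apply: radical_vanishing => // u /IZ/zeros_ideal_B_closure/zeros_radical[_].
exact.
Qed.
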